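(* Let $\mathfrak{m}$ be a finitely presented Lie algebra over a field $\mathbb{K}$ and let $i\ge 2$. Then $\mathfrak{m}^{\otimes i}$ is finitely presented if and only if $\gamma_i(\mathfrak{m})$ is finitely presented.
   Context: $\mathbb{K}$ is a field; Lie algebras are over $\mathbb{K}$, and ''finitely presented'' means finitely presented as a Lie algebra. The lower central series is $\gamma_1(\mathfrak{m})=\mathfrak{m}$, $\gamma_{i+1}(\mathfrak{m})=[\gamma_i(\mathfrak{m}),\mathfrak{m}]$ for $i\ge 1$. A Lie action of $\mathfrak{m}$ on $\mathfrak{n}$ is a bilinear map $(m,n)\mapsto{}^mn\in\mathfrak{n}$ with ${}^{[m,m']}n={}^m({}^{m'}n)-{}^{m'}({}^mn)$ and ${}^m[n,n']=[{}^mn,n']+[n,{}^mn']$. If $\mathfrak{m}$ and $\mathfrak{n}$ act on each other, the actions are compatible when ${}^{({}^mn)}m'=[m',{}^nm]$ and ${}^{({}^nm)}n'=[n',{}^mn]$ for all $m,m'\in\mathfrak{m}$, $n,n'\in\mathfrak{n}$. For Lie algebras $\mathfrak{m},\mathfrak{n}$ acting on each other, the non-abelian tensor product $\mathfrak{m}\otimes\mathfrak{n}$ is the Lie algebra generated by symbols $m\otimes n$ ($m\in\mathfrak{m}$, $n\in\mathfrak{n}$) subject to, for all $k\in\mathbb{K}$, $m,m'\in\mathfrak{m}$, $n,n'\in\mathfrak{n}$: $k(m\otimes n)=km\otimes n=m\otimes kn$; $(m+m')\otimes n=m\otimes n+m'\otimes n$; $m\otimes(n+n')=m\otimes n+m\otimes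 n'$; $m\otimes[n,n']={}^{n'}m\otimes n-{}^nm\otimes n'$; $[m,m']\otimes n=m\otimes{}^{m'}n-m'\otimes{}^mn$; $[m\otimes n,m'\otimes n']=-{}^nm\otimes{}^{m'}n'$. There is an induced Lie homomorphism $\nu\colon\mathfrak{m}\otimes\mathfrak{n}\to\mathfrak{n}$ with $\nu(m\otimes n)={}^mn$. When the actions of $\mathfrak{m}$ and $\mathfrak{n}$ are compatible, $\mathfrak{n}$ acts on $\mathfrak{m}\otimes\mathfrak{n}$ by ${}^{n}(m'\otimes n')={}^{n}m'\otimes n'+m'\otimes[n,n']$ and $\mathfrak{m}\otimes\mathfrak{n}$ acts on $\mathfrak{n}$ by ${}^{\omega}n=[\nu(\omega),n]$; these mutual actions are again compatible, so $(\mathfrak{m}\otimes\mathfrak{n})\otimes\mathfrak{n}$ is defined, and so on inductively. Starting from $\mathfrak{n}=\mathfrak{m}$, with $\mathfrak{m}$ acting on itself by ${}^mm'=[m,m']$, set $\mathfrak{m}^{\otimes 1}=\mathfrak{m}$, $\mathfrak{m}^{\otimes 2}=\mathfrak{m}\otimes\mathfrak{m}$ and $\mathfrak{m}^{\otimes i+1}=(\mathfrak{m}^{\otimes i})\otimes\mathfrak{m}$ for $i\ge 1$. *)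

(* Defs.v *)
From HB Require Import structures.
From mathcomp Require Import all_boot all_order all_algebra.
From mathcomp Require Import boolp.

Set Implicit Arguments.
Unset Strict Implicit.
Unset Printing Implicit Defensive.

Import GRing.Theory.
Local Open Scope ring_scope.
Local Open Scope quotient_scope.

(* Lie algebras of arbitrary dimension over a field of arbitrary              *)
(* characteristic; the bracket is alternating, not merely antisymmetric.      *)
HB.mixin Record Lmodule_isLieAlgebra (K : fieldType) L & GRing.Lmodule K L := {
  lie : L -> L -> L;
  lie_linearl : forall y, linear (fun x => lie x y);
  lie_linearr : forall x, linear (lie x);
  liexx : forall x, lie x x = 0;
  lie_jacobi : forall x y z,
    lie x (lie y z) + lie y (lie z x) + lie z (lie x y) = 0
}.

#[short(type="lieType")]
HB.structure Definition LieAlgebra (K : fieldType) :=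
  { L of GRing.Lmodule K L & Lmodule_isLieAlgebra K L }.

Notation "[ 'lie' x , y ]" := (lie x y)
  (at level 0, format "[ 'lie'  x ,  y ]") : ring_scope.

Section LieTheory.
Variables (K : fieldType) (L : lieType K).
Implicit Types x y z : L.

HB.instance Definition _ x :=
  GRing.isLinear.Build K L L *:%R (lie x) (lie_linearr x).

Definition lier y x : L := [lie x, y].
HB.instance Definition _ y :=
  GRing.isLinear.Build K L L *:%R (lier y) (lie_linearl y).

Lemma lieDl x y z : [lie x + y, z] = [lie x, z] + [lie y, z].
Proof. exact: (raddfD (lier z)). Qed.
Lemma lieDr x y z : [lie x, y + z] = [lie x, y] + [lie x, z].
Proof. exact: raddfD. Qed.
Lemma lieNl x y : [lie - x, y] = - [lie x, y].
Proof. exact: (raddfN (lier y)). Qed.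
Lemma lieNr x y : [lie x, - y] = - [lie x, y].
Proof. exact: raddfN. Qed.
Lemma lieBl x y z : [lie x - y, z] = [lie x, z] - [lie y, z].
Proof. by rewrite lieDl lieNl. Qed.
Lemma lieBr x y z : [lie x, y - z] = [lie x, y] - [lie x, z].
Proof. by rewrite lieDr lieNr. Qed.
Lemma lieZl k x y : [lie k *: x, y] = k *: [lie x, y].
Proof. exact: (linearZ_LR (lier y)). Qed.
Lemma lieZr k x y : [lie x, k *: y] = k *: [lie x, y].
Proof. exact: linearZ_LR. Qed.
Lemma lie0l y : [lie 0, y] = 0 :> L.
Proof. exact: (raddf0 (lier y)). Qed.
Lemma lie0r x : [lie x, 0] = 0 :> L.
Proof. exact: raddf0. Qed.

Lemma lieC x y : [lie x, y] = - [lie y, x].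
Proof.
apply/eqP; rewrite -addr_eq0; apply/eqP.
by move: (liexx (x + y)); rewrite !(lieDl, lieDr) !liexx add0r addr0.
Qed.

Lemma lie_leibniz x y z :
  [lie x, [lie y, z]] = [lie [lie x, y], z] + [lie y, [lie x, z]].
Proof.
apply/eqP; rewrite -subr_eq0 -(lie_jacobi x y z) -addrA opprD addrA.
rewrite [[lie [lie x, y], z]]lieC opprK [[lie z, x]]lieC lieNr.
by rewrite -!addrA [X in _ + X]addrC.
Qed.

Lemma lie_liel x y z :
  [lie [lie x, y], z] = [lie x, [lie y, z]] - [lie y, [lie x, z]].
Proof. by rewrite lie_leibniz addrK. Qed.

End LieTheory.

Section Sums.
Variables (V : zmodType) (a b c d e f : V).
Fact sum_aux1 : a - b + (c - (d - b) + (e - a - f)) = e + c - (d + f).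
Proof.
rewrite opprB opprD !addrA [LHS](ACl ((1*7)*(2*4)*6*3*5*8)) /=.
by rewrite addrN addNr !add0r.
Qed.
Fact sum_aux2 : a + b + (- c - d) + (c + e - (b + f)) = a + e - (d + f).
Proof.
rewrite !opprD !addrA [LHS](ACl ((2*7)*(3*5)*1*6*4*8)) /=.
by rewrite addrN addNr !add0r.
Qed.
Fact sum_aux3 : - a - (d - a) + (b - (b + c)) = - (d + c).
Proof.
rewrite opprB !opprD !addrA [LHS](ACl ((1*2)*(4*5)*3*6)) /=.
by rewrite addrN addNr !add0r.
Qed.
Fact sum_aux4 : a - b + (c - d) = a + e + (f + c) - (b + f + (e + d)).
Proof.
rewrite !opprD !addrA [RHS](ACl ((2*7)*(3*6)*1*5*4*8)) /=.
by rewrite !addrN !add0r.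
Qed.
End Sums.

Definition lie_isomorphic (K : fieldType) (L L' : lieType K) : Prop :=
  exists f : {linear L -> L'},
    (forall x y, f [lie x, y] = [lie f x, f y]) /\ bijective f.

(* Lie algebras given by generators and relations: a presented algebra is the *)
(* set of formal Lie expressions in the generators, modulo the smallest       *)
(* congruence containing the relations and the Lie algebra axioms.            *)
Inductive lie_term (K X : Type) : Type :=
| LVar of X
| LZero
| LOpp of lie_term K X
| LAdd of lie_term K X & lie_term K X
| LScale of K & lie_term K X
| LLie of lie_term K X & lie_term K X.
Arguments LVar {K X}.
Arguments LZero {K X}.

HB.instance Definition _ (K X : Type) := gen_eqMixin (lie_term K X).
HB.instance Definition _ (K X : Type) := gen_choiceMixin (lie_term K X).

Inductive lie_cong (K : fieldType) (X : Type)
    (R : lie_term K X -> lie_term K X -> Prop) :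
  lie_term K X -> lie_term K X -> Prop :=
| cong_rel a b : R a b -> lie_cong R a b
| cong_refl a : lie_cong R a a
| cong_sym a b : lie_cong R a b -> lie_cong R b a
| cong_trans a b c : lie_cong R a b -> lie_cong R b c -> lie_cong R a c
| cong_opp a b : lie_cong R a b -> lie_cong R (LOpp a) (LOpp b)
| cong_add a b c d : lie_cong R a b -> lie_cong R c d ->
    lie_cong R (LAdd a c) (LAdd b d)
| cong_scale k a b : lie_cong R a b -> lie_cong R (LScale k a) (LScale k b)
| cong_lie a b c d : lie_cong R a b -> lie_cong R c d ->
    lie_cong R (LLie a c) (LLie b d)
| cong_addA a b c : lie_cong R (LAdd a (LAdd b c)) (LAdd (LAdd a b) c)
| cong_addC a b : lie_cong R (LAdd a b) (LAdd b a)
| cong_add0 a : lie_cong R (LAdd LZero a) a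
| cong_addN a : lie_cong R (LAdd (LOpp a) a) LZero
| cong_scaleA k l a : lie_cong R (LScale k (LScale l a)) (LScale (k * l) a)
| cong_scale1 a : lie_cong R (LScale 1 a) a
| cong_scaleDr k a b :
    lie_cong R (LScale k (LAdd a b)) (LAdd (LScale k a) (LScale k b))
| cong_scaleDl a k l :
    lie_cong R (LScale (k + l) a) (LAdd (LScale k a) (LScale l a))
| cong_linearl c k a b :
    lie_cong R (LLie (LAdd (LScale k a) b) c)
               (LAdd (LScale k (LLie a c)) (LLie b c))
| cong_linearr c k a b :
    lie_cong R (LLie c (LAdd (LScale k a) b))
               (LAdd (LScale k (LLie c a)) (LLie c b))
| cong_liexx a : lie_cong R (LLie a a) LZero
| cong_jacobi a b c :
    lie_cong R (LAdd (LAdd (LLie a (LLie b c)) (LLie b (LLie c a)))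
                     (LLie c (LLie a b))) LZero.

Section Presented.
Variables (K : fieldType) (X : Type) (R : lie_term K X -> lie_term K X -> Prop).

Definition lie_congb (a b : lie_term K X) : bool := `[< lie_cong R a b >].

Lemma lie_congb_refl : reflexive lie_congb.
Proof. by move=> a; apply/asboolP; constructor. Qed.
Lemma lie_congb_sym : symmetric lie_congb.
Proof. by move=> a b; apply/asboolP/asboolP; apply: cong_sym. Qed.
Lemma lie_congb_trans : transitive lie_congb.
Proof.
move=> b a c /asboolP ab /asboolP bc; apply/asboolP; exact: cong_trans ab bc.
Qed.

Canonical lie_cong_equiv :=
  EquivRel lie_congb lie_congb_refl lie_congb_sym lie_congb_trans.

Definition presented : Type := {eq_quot lie_cong_equiv}.
HB.instance Definition _ := Choice.on presented.

Definition pres_class (t : lie_term K X) : presented :=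
  \pi_({eq_quot lie_cong_equiv}) t.
Definition pres_repr (x : presented) : lie_term K X :=
  repr (x : {eq_quot lie_cong_equiv}).

Lemma pres_reprK x : pres_class (pres_repr x) = x.
Proof. exact: reprK. Qed.

Lemma pres_classP a b : pres_class a = pres_class b <-> lie_cong R a b.
Proof.
split; first by move/eqmodP/asboolP.
by move=> ab; apply/eqmodP/asboolP.
Qed.

Lemma pres_repr_class a : lie_cong R (pres_repr (pres_class a)) a.
Proof. by apply/pres_classP; rewrite pres_reprK. Qed.

Definition pres_zero : presented := pres_class LZero.
Definition pres_opp x : presented := pres_class (LOpp (pres_repr x)).
Definition pres_add x y : presented :=
  pres_class (LAdd (pres_repr x) (pres_repr y)).
Definition pres_scale k x : presented := pres_class (LScale k (pres_repr x)).
Definition pres_lie x y : presented :=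
  pres_class (LLie (pres_repr x) (pres_repr y)).

Lemma pres_oppE a : pres_opp (pres_class a) = pres_class (LOpp a).
Proof. by apply/pres_classP/cong_opp/pres_repr_class. Qed.
Lemma pres_addE a b :
  pres_add (pres_class a) (pres_class b) = pres_class (LAdd a b).
Proof. by apply/pres_classP/cong_add; apply: pres_repr_class. Qed.
Lemma pres_scaleE k a : pres_scale k (pres_class a) = pres_class (LScale k a).
Proof. by apply/pres_classP/cong_scale/pres_repr_class. Qed.
Lemma pres_lieE a b :
  pres_lie (pres_class a) (pres_class b) = pres_class (LLie a b).
Proof. by apply/pres_classP/cong_lie; apply: pres_repr_class. Qed.
Let presE := (pres_oppE, pres_addE, pres_scaleE, pres_lieE).

Fact pres_addA : associative pres_add.
Proof.
move=> x y z; rewrite -[x]pres_reprK -[y]pres_reprK -[z]pres_reprK !presE.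
by apply/pres_classP; constructor.
Qed.
Fact pres_addC : commutative pres_add.
Proof.
move=> x y; rewrite -[x]pres_reprK -[y]pres_reprK !presE.
by apply/pres_classP; constructor.
Qed.
Fact pres_add0 : left_id pres_zero pres_add.
Proof.
move=> x; rewrite -[x]pres_reprK presE; by apply/pres_classP; constructor.
Qed.
Fact pres_addN : left_inverse pres_zero pres_opp pres_add.
Proof.
move=> x; rewrite -[x]pres_reprK !presE; by apply/pres_classP; constructor.
Qed.
HB.instance Definition _ :=
  GRing.isZmodule.Build presented pres_addA pres_addC pres_add0 pres_addN.

Fact pres_scaleA k l x : pres_scale k (pres_scale l x) = pres_scale (k * l) x.
Proof.
rewrite -[x]pres_reprK !presE; by apply/pres_classP; constructor.
Qed.
Fact pres_scale1 : left_id 1 pres_scale.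
Proof.
move=> x; rewrite -[x]pres_reprK !presE; by apply/pres_classP; constructor.
Qed.
Fact pres_scaleDr : right_distributive pres_scale +%R.
Proof.
move=> k x y; rewrite -[x]pres_reprK -[y]pres_reprK.
rewrite -[X in pres_scale _ X]/(pres_add _ _) -[RHS]/(pres_add _ _) !presE.
by apply/pres_classP; constructor.
Qed.
Fact pres_scaleDl x : {morph pres_scale^~ x : k l / k + l}.
Proof.
move=> k l /=; rewrite -[x]pres_reprK -[RHS]/(pres_add _ _) !presE.
by apply/pres_classP; constructor.
Qed.
HB.instance Definition _ := GRing.Zmodule_isLmodule.Build K presented
  pres_scaleA pres_scale1 pres_scaleDr pres_scaleDl.

Lemma class0 : pres_class LZero = 0. Proof. by []. Qed.
Lemma classN a : pres_class (LOpp a) = - pres_class a.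
Proof. by rewrite -presE. Qed.
Lemma classD a b : pres_class (LAdd a b) = pres_class a + pres_class b.
Proof. by rewrite -presE. Qed.
Lemma classZ k a : pres_class (LScale k a) = k *: pres_class a.
Proof. by rewrite -presE. Qed.

Fact pres_linearl y : linear (fun x => pres_lie x y).
Proof.
move=> k a b; rewrite -[a]pres_reprK -[b]pres_reprK -[y]pres_reprK.
rewrite -classZ -classD !presE -classZ -classD.
by apply/pres_classP; constructor.
Qed.
Fact pres_linearr x : linear (pres_lie x).
Proof.
move=> k a b; rewrite -[a]pres_reprK -[b]pres_reprK -[x]pres_reprK.
rewrite -classZ -classD !presE -classZ -classD.
by apply/pres_classP; constructor.
Qed.
Fact pres_liexx x : pres_lie x x = 0.
Proof.
rewrite -[x]pres_reprK presE; by apply/pres_classP; constructor.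
Qed.
Fact pres_jacobi x y z :
  pres_lie x (pres_lie y z) + pres_lie y (pres_lie z x)
    + pres_lie z (pres_lie x y) = 0.
Proof.
rewrite -[x]pres_reprK -[y]pres_reprK -[z]pres_reprK.
rewrite !presE -!classD.
by apply/pres_classP; constructor.
Qed.
HB.instance Definition _ := Lmodule_isLieAlgebra.Build K presented
  pres_linearl pres_linearr pres_liexx pres_jacobi.

Lemma classL a b : pres_class (LLie a b) = [lie pres_class a, pres_class b].
Proof. by rewrite -presE. Qed.

Definition pres_gen (x : X) : presented := pres_class (LVar x).

Lemma pres_ind (P : presented -> Prop) :
    P 0 -> (forall x, P (pres_gen x)) ->
    (forall x y, P x -> P y -> P (x + y)) ->
    (forall k x, P x -> P (k *: x)) ->
    (forall x y, P x -> P y -> P [lie x, y]) ->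
  forall x, P x.
Proof.
move=> P0 Pg PD PZ PL x; rewrite -[x]pres_reprK.
elim: (pres_repr x) => {x} [x||a Pa|a Pa b Pb|k a Pa|a Pa b Pb].
- exact: Pg.
- exact: P0.
- by rewrite classN -scaleN1r; apply: PZ.
- by rewrite classD; apply: PD.
- by rewrite classZ; apply: PZ.
- by rewrite classL; apply: PL.
Qed.

Section Lift.
Variables (L : lieType K) (f : X -> L).

Fixpoint term_eval (t : lie_term K X) : L :=
  match t with
  | LVar x => f x
  | LZero => 0
  | LOpp a => - term_eval a
  | LAdd a b => term_eval a + term_eval b
  | LScale k a => k *: term_eval a
  | LLie a b => [lie term_eval a, term_eval b]
  end.

Hypothesis fR : forall a b, R a b -> term_eval a = term_eval b.

Lemma term_eval_cong a b : lie_cong R a b -> term_eval a = term_eval b.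
Proof.
elim=> /=.
- exact: fR.
- by [].
- by [].
- by move=> ? ? ? _ -> _ ->.
- by move=> ? ? _ ->.
- by move=> ? ? ? ? _ -> _ ->.
- by move=> ? ? ? _ ->.
- by move=> ? ? ? ? _ -> _ ->.
- by move=> *; rewrite addrA.
- by move=> *; rewrite addrC.
- by move=> *; rewrite add0r.
- by move=> *; rewrite addNr.
- by move=> *; rewrite scalerA.
- by move=> *; rewrite scale1r.
- by move=> *; rewrite scalerDr.
- by move=> *; rewrite scalerDl.
- by move=> *; rewrite lieDl lieZl.
- by move=> *; rewrite lieDr lieZr.
- by move=> *; rewrite liexx.
- by move=> *; rewrite lie_jacobi.
Qed.

Definition pres_lift (x : presented) : L := term_eval (pres_repr x).

Lemma pres_lift_class a : pres_lift (pres_class a) = term_eval a.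
Proof. exact/term_eval_cong/pres_repr_class. Qed.

Lemma pres_lift_gen x : pres_lift (pres_gen x) = f x.
Proof. exact: pres_lift_class. Qed.

Lemma pres_lift_linear : linear pres_lift.
Proof.
move=> k x y; rewrite -[x]pres_reprK -[y]pres_reprK -classZ -classD.
by rewrite !pres_lift_class.
Qed.

Lemma pres_lift_lie x y :
  pres_lift [lie x, y] = [lie pres_lift x, pres_lift y].
Proof.
rewrite -[x]pres_reprK -[y]pres_reprK -classL.
by rewrite !pres_lift_class.
Qed.

End Lift.

Section Derivation.
Variable f : X -> presented.

Fixpoint term_der (t : lie_term K X) : presented :=
  match t with
  | LVar x => f x
  | LZero => 0
  | LOpp a => - term_der a
  | LAdd a b => term_der a + term_der b
  | LScale k a => k *: term_der a
  | LLie a b => [lie term_der a, pres_class b] + [lie pres_class a, term_der b]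
  end.

Hypothesis fR : forall a b, R a b -> term_der a = term_der b.

Lemma term_der_cong a b : lie_cong R a b -> term_der a = term_der b.
Proof.
move=> ab; suff [] : term_der a = term_der b /\ pres_class a = pres_class b by [].
split; last exact/pres_classP.
elim: ab => /=.
- exact: fR.
- by [].
- by [].
- by move=> ? ? ? _ -> _ ->.
- by move=> ? ? _ ->.
- by move=> ? ? ? ? _ -> _ ->.
- by move=> ? ? ? _ ->.
- by move=> ? ? ? ? /pres_classP-> -> /pres_classP-> ->.
- by move=> *; rewrite addrA.
- by move=> *; rewrite addrC.
- by move=> *; rewrite add0r.
- by move=> *; rewrite addNr.
- by move=> *; rewrite scalerA.
- by move=> *; rewrite scale1r.
- by move=> *; rewrite scalerDr.
- by move=> *; rewrite scalerDl.
- move=> c k u v; rewrite !classD !classZ !(lieDl, lieDr, lieZl, lieZr).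
  by rewrite scalerDr addrACA.
- move=> c k u v; rewrite !classD !classZ !(lieDl, lieDr, lieZl, lieZr).
  by rewrite scalerDr addrACA.
- by move=> u; rewrite [[lie pres_class u, _]]lieC addrN.
- move=> u v w; rewrite !classL !(lieDl, lieDr).
  set u' := term_der u; set v' := term_der v; set w' := term_der w.
  set pu := pres_class u; set pv := pres_class v; set pw := pres_class w.
  rewrite !addrA [LHS](ACl ((1*6*8)*(2*4*9)*(3*5*7))) /=.
  by rewrite !lie_jacobi !addr0.
Qed.

Definition pres_der (x : presented) : presented := term_der (pres_repr x).

Lemma pres_der_class a : pres_der (pres_class a) = term_der a.
Proof. exact/term_der_cong/pres_repr_class. Qed.

Lemma pres_der_gen x : pres_der (pres_gen x) = f x.
Proof. exact: pres_der_class. Qed.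

Lemma pres_der_linear : linear pres_der.
Proof.
move=> k x y; rewrite -[x]pres_reprK -[y]pres_reprK -classZ -classD.
by rewrite !pres_der_class.
Qed.

Lemma pres_der_lie x y :
  pres_der [lie x, y] = [lie pres_der x, y] + [lie x, pres_der y].
Proof.
rewrite -[x]pres_reprK -[y]pres_reprK -classL.
by rewrite !pres_der_class.
Qed.

End Derivation.

End Presented.

Definition finitely_presented (K : fieldType) (L : lieType K) : Prop :=
  exists (n : nat) (r : seq (lie_term K 'I_n * lie_term K 'I_n)),
    lie_isomorphic (presented (fun a b => (a, b) \in r)) L.

(* Membership in [A, L], the linear span of the brackets [a, x], a \in A. *)
Inductive in_commutator (K : fieldType) (L : lieType K) (A : {pred L}) :
  L -> Prop :=
| in_comm_lie a x : a \in A -> in_commutator A [lie a, x]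
| in_comm0 : in_commutator A 0
| in_commD x y : in_commutator A x -> in_commutator A y ->
    in_commutator A (x + y)
| in_commZ k x : in_commutator A x -> in_commutator A (k *: x).

(* Numbered from 1, as usual; the index 0 also denotes the whole algebra. *)
Definition lower_central (K : fieldType) (L : lieType K) (i : nat) : {pred L} :=
  iter i.-1 (fun A : {pred L} => fun x => `[< in_commutator A x >]) predT.
Arguments lower_central {K} L i.

Section LowerCentral.
Variables (K : fieldType) (L : lieType K) (i : nat).

Lemma lower_central_ideal (x y : L) :
  x \in lower_central L i -> [lie x, y] \in lower_central L i.
Proof.
rewrite /lower_central; elim: (i.-1) x y => [//|j IH] x y /asboolP xA.
apply/asboolP; elim: xA y => /= {x}.
- by move=> a z aA y; apply: in_comm_lie; apply: IH.
- by move=> y; rewrite lie0l; apply: in_comm0.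
- by move=> a b _ IHa _ IHb y; rewrite lieDl; apply: in_commD.
- by move=> k a _ IHa y; rewrite lieZl; apply: in_commZ.
Qed.

Fact lower_central_submod : submod_closed (lower_central L i).
Proof.
rewrite /lower_central; case: (i.-1) => [//|j]; split => [|k x y].
  by apply/asboolP; apply: in_comm0.
move=> /asboolP xA /asboolP yA; apply/asboolP.
by apply: in_commD => //; apply: in_commZ.
Qed.
HB.instance Definition _ :=
  GRing.isSubmodClosed.Build K L (lower_central L i) lower_central_submod.

Record gamma : Type := Gamma {
  gamma_val :> L;
  gamma_valP : gamma_val \in lower_central L i
}.
HB.instance Definition _ := [isSub for gamma_val].
HB.instance Definition _ := [Choice of gamma by <:].
HB.instance Definition _ := [SubChoice_isSubLmodule of gamma by <:].

Definition gamma_lie (x y : gamma) : gamma :=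
  Gamma (lower_central_ideal y (gamma_valP x)).

Fact gamma_linearl y : linear (fun x => gamma_lie x y).
Proof. by move=> k a b; apply: val_inj; rewrite /= lieDl lieZl. Qed.
Fact gamma_linearr x : linear (gamma_lie x).
Proof. by move=> k a b; apply: val_inj; rewrite /= lieDr lieZr. Qed.
Fact gamma_liexx x : gamma_lie x x = 0.
Proof. by apply: val_inj; rewrite /= liexx. Qed.
Fact gamma_jacobi x y z :
  gamma_lie x (gamma_lie y z) + gamma_lie y (gamma_lie z x)
    + gamma_lie z (gamma_lie x y) = 0.
Proof. by apply: val_inj; rewrite /= lie_jacobi. Qed.
HB.instance Definition _ := Lmodule_isLieAlgebra.Build K gamma
  gamma_linearl gamma_linearr gamma_liexx gamma_jacobi.

End LowerCentral.
Arguments gamma {K} L i.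

Record lie_action (K : fieldType) (M N : lieType K) := LieAction {
  act :> M -> N -> N;
  act_linearl : forall n, linear (fun m => act m n);
  act_linearr : forall m, linear (act m);
  act_liel : forall m m' n,
    act [lie m, m'] n = act m (act m' n) - act m' (act m n);
  act_lier : forall m n n',
    act m [lie n, n'] = [lie act m n, n'] + [lie n, act m n']
}.

Section ActionTheory.
Variables (K : fieldType) (M N : lieType K) (a : lie_action M N).

HB.instance Definition _ m :=
  GRing.isLinear.Build K N N *:%R (a m) (act_linearr a m).
Definition actr n m : N := a m n.
HB.instance Definition _ n :=
  GRing.isLinear.Build K M N *:%R (actr n) (act_linearl a n).

Lemma actDl m m' n : a (m + m') n = a m n + a m' n.
Proof. exact: (raddfD (actr n)). Qed.
Lemma actDr m n n' : a m (n + n') = a m n + a m n'.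
Proof. exact: raddfD. Qed.
Lemma actNl m n : a (- m) n = - a m n.
Proof. exact: (raddfN (actr n)). Qed.
Lemma actNr m n : a m (- n) = - a m n.
Proof. exact: raddfN. Qed.
Lemma actZl k m n : a (k *: m) n = k *: a m n.
Proof. exact: (linearZ_LR (actr n)). Qed.
Lemma actZr k m n : a m (k *: n) = k *: a m n.
Proof. exact: linearZ_LR. Qed.
Lemma act0l n : a 0 n = 0.
Proof. exact: (raddf0 (actr n)). Qed.
Lemma act0r m : a m 0 = 0.
Proof. exact: raddf0. Qed.
End ActionTheory.

Definition lie_adjoint (K : fieldType) (M : lieType K) : lie_action M M :=
  LieAction (@lie_linearl K M) (@lie_linearr K M) (@lie_liel K M)
    (@lie_leibniz K M).

Definition compatible (K : fieldType) (M N : lieType K)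
    (aMN : lie_action M N) (aNM : lie_action N M) : Prop :=
  (forall m m' n, aNM (aMN m n) m' = [lie m', aNM n m]) /\
  (forall m n n', aMN (aNM n m) n' = [lie n', aMN m n]).

Section Tensor.
Variables (K : fieldType) (M N : lieType K).
Variables (aMN : lie_action M N) (aNM : lie_action N M).

Local Notation "m ⊗ n" := (LVar (m, n)) (at level 35).

Inductive tensor_rel : lie_term K (M * N) -> lie_term K (M * N) -> Prop :=
| tensor_Zl k m n : tensor_rel (LScale k (m ⊗ n)) ((k *: m) ⊗ n)
| tensor_Zr k m n : tensor_rel (LScale k (m ⊗ n)) (m ⊗ (k *: n))
| tensor_Dl m m' n : tensor_rel ((m + m') ⊗ n) (LAdd (m ⊗ n) (m' ⊗ n))
| tensor_Dr m n n' : tensor_rel (m ⊗ (n + n')) (LAdd (m ⊗ n) (m ⊗ n'))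
| tensor_lier m n n' :
    tensor_rel (m ⊗ [lie n, n'])
               (LAdd ((aNM n' m) ⊗ n) (LOpp ((aNM n m) ⊗ n')))
| tensor_liel m m' n :
    tensor_rel ([lie m, m'] ⊗ n)
               (LAdd (m ⊗ (aMN m' n)) (LOpp (m' ⊗ (aMN m n))))
| tensor_lie m m' n n' :
    tensor_rel (LLie (m ⊗ n) (m' ⊗ n')) (LOpp ((aNM n m) ⊗ (aMN m' n'))).

Definition tensor : lieType K := presented tensor_rel.

Definition tens (m : M) (n : N) : tensor := pres_gen tensor_rel (m, n).

Lemma tens_rel a b : tensor_rel a b ->
  pres_class tensor_rel a = pres_class tensor_rel b.
Proof. by move=> ab; apply/pres_classP; apply: cong_rel. Qed.

Lemma tensZl k m n : tens (k *: m) n = k *: tens m n.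
Proof. by rewrite -classZ; apply/esym/tens_rel; constructor. Qed.
Lemma tensZr k m n : tens m (k *: n) = k *: tens m n.
Proof. by rewrite -classZ; apply/esym/tens_rel; constructor. Qed.
Lemma tensDl m m' n : tens (m + m') n = tens m n + tens m' n.
Proof. by rewrite -classD; apply/tens_rel; constructor. Qed.
Lemma tensDr m n n' : tens m (n + n') = tens m n + tens m n'.
Proof. by rewrite -classD; apply/tens_rel; constructor. Qed.
Lemma tensNl m n : tens (- m) n = - tens m n.
Proof. by rewrite -scaleN1r tensZl scaleN1r. Qed.
Lemma tensNr m n : tens m (- n) = - tens m n.
Proof. by rewrite -scaleN1r tensZr scaleN1r. Qed.
Lemma tens_lier m n n' :
  tens m [lie n, n'] = tens (aNM n' m) n - tens (aNM n m) n'.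
Proof. by rewrite -classN -classD; apply/tens_rel; constructor. Qed.
Lemma tens_liel m m' n :
  tens [lie m, m'] n = tens m (aMN m' n) - tens m' (aMN m n).
Proof. by rewrite -classN -classD; apply/tens_rel; constructor. Qed.
Lemma tens_lie m m' n n' :
  [lie tens m n, tens m' n'] = - tens (aNM n m) (aMN m' n').
Proof. by rewrite -classL -classN; apply/tens_rel; constructor. Qed.

Definition tensor_nu : tensor -> N :=
  pres_lift (fun p : M * N => aMN p.1 p.2).

(* Action of n on generators; extended below as a derivation. *)
Definition tensor_act_gen (n : N) (p : M * N) : tensor :=
  tens (aNM n p.1) p.2 + tens p.1 [lie n, p.2].

Definition tensor_act (n : N) : tensor -> tensor :=
  pres_der (tensor_act_gen n).

Hypothesis compat : compatible aMN aNM.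
Let compM := compat.1.
Let compN := compat.2.

Lemma tensor_nu_rel a b : tensor_rel a b ->
  term_eval (fun p : M * N => aMN p.1 p.2) a =
  term_eval (fun p : M * N => aMN p.1 p.2) b.
Proof.
case=> /= {a b}.
- by move=> *; rewrite actZl.
- by move=> *; rewrite actZr.
- by move=> *; rewrite actDl.
- by move=> *; rewrite actDr.
- by move=> m n n'; rewrite act_lier !compN [[lie n', _]]lieC addrC opprK addrC.
- by move=> m m' n; rewrite act_liel.
- by move=> m m' n n'; rewrite compN lieC.
Qed.

Lemma tensor_nu_tens m n : tensor_nu (tens m n) = aMN m n.
Proof. exact/pres_lift_gen/tensor_nu_rel. Qed.
Lemma tensor_nu_linear : linear tensor_nu.
Proof. exact/pres_lift_linear/tensor_nu_rel. Qed.
Lemma tensor_nu_lie x y : tensor_nu [lie x, y] = [lie tensor_nu x, tensor_nu y].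
Proof. exact/pres_lift_lie/tensor_nu_rel. Qed.
Lemma tensor_nuD x y : tensor_nu (x + y) = tensor_nu x + tensor_nu y.
Proof. by rewrite -[x]scale1r tensor_nu_linear !scale1r. Qed.
Lemma tensor_nu0 : tensor_nu 0 = 0.
Proof. by apply: (addrI (tensor_nu 0)); rewrite -tensor_nuD !addr0. Qed.
Lemma tensor_nuZ k x : tensor_nu (k *: x) = k *: tensor_nu x.
Proof. by rewrite -[k *: x]addr0 tensor_nu_linear tensor_nu0 addr0. Qed.

Lemma tensor_act_rel p a b : tensor_rel a b ->
  term_der (tensor_act_gen p) a = term_der (tensor_act_gen p) b.
Proof.
case=> /= {a b}; rewrite /tensor_act_gen /=.
- by move=> k m n; rewrite actZr !tensZl scalerDr.
- by move=> k m n; rewrite lieZr !tensZr scalerDr.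
- by move=> m m' n; rewrite actDr !tensDl addrACA.
- by move=> m n n'; rewrite lieDr !tensDr addrACA.
- move=> m n n'; rewrite lie_leibniz tensDr !tens_lier !act_liel.
  rewrite !(tensDl, tensNl); exact: sum_aux1.
- move=> m m' n; rewrite act_lier tensDl !tens_liel !compN !act_lier.
  rewrite [[lie n, aMN m p]]lieC [[lie n, aMN m' p]]lieC !(tensDr, tensNr) opprK.
  exact: sum_aux2.
- move=> m m' n n'.
  rewrite -[pres_class _ (LVar (m, n))]/(tens m n).
  rewrite -[pres_class _ (LVar (m', n'))]/(tens m' n').
  rewrite lieDl lieDr !tens_lie compN act_liel act_lier.
  rewrite [[lie n', _]]lieC !(tensDr, tensNr, tensDl, tensNl) opprK.
  exact: sum_aux3.
Qed.

Lemma tensor_act_tens p m n :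
  tensor_act p (tens m n) = tens (aNM p m) n + tens m [lie p, n].
Proof. exact/pres_der_gen/tensor_act_rel. Qed.
Lemma tensor_act_linearr p : linear (tensor_act p).
Proof. exact/pres_der_linear/tensor_act_rel. Qed.
Lemma tensor_act_lier p x y :
  tensor_act p [lie x, y] = [lie tensor_act p x, y] + [lie x, tensor_act p y].
Proof. exact/pres_der_lie/tensor_act_rel. Qed.
Lemma tensor_actD p x y : tensor_act p (x + y) = tensor_act p x + tensor_act p y.
Proof. by rewrite -[x]scale1r tensor_act_linearr !scale1r. Qed.
Lemma tensor_act0 p : tensor_act p 0 = 0.
Proof. by apply: (addrI (tensor_act p 0)); rewrite -tensor_actD !addr0. Qed.
Lemma tensor_actZ p k x : tensor_act p (k *: x) = k *: tensor_act p x.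
Proof. by rewrite -[k *: x]addr0 tensor_act_linearr tensor_act0 addr0. Qed.

Lemma tensor_ind (P : tensor -> Prop) :
    P 0 -> (forall m n, P (tens m n)) ->
    (forall x y, P x -> P y -> P (x + y)) ->
    (forall k x, P x -> P (k *: x)) ->
    (forall x y, P x -> P y -> P [lie x, y]) ->
  forall x, P x.
Proof. by move=> P0 Pt; apply: pres_ind => // -[m n]; apply: Pt. Qed.

Lemma tensor_act_linearl x : linear (fun p => tensor_act p x).
Proof.
move=> k p q; elim/tensor_ind: x => [|m n|x y IHx IHy|c x IHx|x y IHx IHy].
- by rewrite !tensor_act0 scaler0 addr0.
- rewrite !tensor_act_tens actDl actZl tensDl tensZl lieDl lieZl tensDr tensZr.
  by rewrite scalerDr addrACA.
- by rewrite !tensor_actD IHx IHy scalerDr addrACA.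
- by rewrite !tensor_actZ IHx scalerDr !scalerA mulrC.
- rewrite !tensor_act_lier IHx IHy !(lieDl, lieDr, lieZl, lieZr).
  by rewrite scalerDr addrACA.
Qed.

Lemma tensor_act_liel p q x :
  tensor_act [lie p, q] x =
    tensor_act p (tensor_act q x) - tensor_act q (tensor_act p x).
Proof.
elim/tensor_ind: x => [|m n|x y IHx IHy|c x IHx|x y IHx IHy].
- by rewrite !tensor_act0 subr0.
- rewrite !tensor_act_tens !tensor_actD !tensor_act_tens act_liel lie_liel.
  rewrite !(tensDl, tensNl, tensDr, tensNr); exact: sum_aux4.
- by rewrite !tensor_actD IHx IHy opprD addrACA.
- by rewrite !tensor_actZ IHx scalerBr.
- rewrite !tensor_act_lier !tensor_actD !tensor_act_lier IHx IHy lieBl lieBr.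
  exact: sum_aux4.
Qed.

(* The action of N on M ⊗ N. *)
Definition tensor_actl : lie_action N tensor :=
  LieAction tensor_act_linearl tensor_act_linearr tensor_act_liel
    tensor_act_lier.

(* The action of M ⊗ N on N. *)
Definition tensor_nu_act (w : tensor) (n : N) : N := [lie tensor_nu w, n].

Fact tensor_nu_act_linearl n : linear (fun w => tensor_nu_act w n).
Proof.
by move=> k x y; rewrite /tensor_nu_act tensor_nu_linear lieDl lieZl.
Qed.
Fact tensor_nu_act_liel x y n :
  tensor_nu_act [lie x, y] n =
    tensor_nu_act x (tensor_nu_act y n) - tensor_nu_act y (tensor_nu_act x n).
Proof. by rewrite /tensor_nu_act tensor_nu_lie lie_liel. Qed.

Definition tensor_actr : lie_action tensor N :=
  LieAction tensor_nu_act_linearl (fun w => lie_linearr (tensor_nu w))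
    tensor_nu_act_liel (fun w => lie_leibniz (tensor_nu w)).

Lemma tensor_nu_equivariant n x :
  tensor_nu (tensor_actl n x) = [lie n, tensor_nu x].
Proof.
elim/tensor_ind: x => [|m p|x y IHx IHy|c x IHx|x y IHx IHy] /=.
- by rewrite tensor_act0 tensor_nu0 lie0r.
- rewrite tensor_act_tens tensor_nuD !tensor_nu_tens compN act_lier.
  by rewrite [[lie p, _]]lieC addKr.
- by rewrite tensor_actD !tensor_nuD IHx IHy lieDr.
- by rewrite tensor_actZ !tensor_nuZ IHx lieZr.
- by rewrite tensor_act_lier tensor_nuD !tensor_nu_lie IHx IHy -lie_leibniz.
Qed.

Lemma tensor_peiffer x y : tensor_actl (tensor_nu x) y = [lie x, y].
Proof.
elim/tensor_ind: x y => [|m n|x x' IHx IHx'|c x IHx|x x' IHx IHx'] y.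
- by rewrite tensor_nu0 act0l lie0l.
- rewrite tensor_nu_tens.
  elim/tensor_ind: y => [|m' n'|x y IHx IHy|c x IHx|x y IHx IHy].
  + by rewrite act0r lie0r.
  + rewrite /= tensor_act_tens tens_lier addrC subrK.
    by rewrite lieC tens_lie opprK.
  + by rewrite actDr lieDr IHx IHy.
  + by rewrite actZr lieZr IHx.
  + by rewrite act_lier IHx IHy -lie_leibniz.
- by rewrite tensor_nuD actDl IHx IHx' lieDl.
- by rewrite tensor_nuZ actZl IHx lieZl.
- by rewrite tensor_nu_lie act_liel !IHx !IHx' lie_liel.
Qed.

Lemma tensor_compatible : compatible tensor_actr tensor_actl.
Proof.
split=> [w w' n|w n n'].
  rewrite -[tensor_actr w n]/[lie tensor_nu w, n] lieC -tensor_nu_equivariant.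
  by rewrite actNl tensor_peiffer [RHS]lieC.
rewrite -[LHS]/[lie tensor_nu (tensor_actl n w), n'] tensor_nu_equivariant.
by rewrite lieC -lieNr -lieC.
Qed.

End Tensor.

Record compatible_pair (K : fieldType) (N : lieType K) := CompatiblePair {
  pair_alg :> lieType K;
  pair_actl : lie_action pair_alg N;
  pair_actr : lie_action N pair_alg;
  pair_compat : compatible pair_actl pair_actr
}.

Section TensorPower.
Variables (K : fieldType) (M : lieType K).

Fact adjoint_compatible : compatible (lie_adjoint M) (lie_adjoint M).
Proof.
split=> [m m' n|m n n'] /=; first by rewrite lieC [[lie m, n]]lieC lieNr opprK.
by rewrite lieC [[lie n, m]]lieC lieNr opprK.
Qed.

Definition tensor_one : compatible_pair M := CompatiblePair adjoint_compatible.

Definition tensor_succ (T : compatible_pair M) : compatible_pair M :=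
  CompatiblePair (tensor_compatible (pair_compat T)).

(* Numbered from 1, as usual; the index 0 also denotes M. *)
Definition tensor_power (i : nat) : compatible_pair M :=
  iter i.-1 tensor_succ tensor_one.

End TensorPower.

(* Main.v *)
Require Import Defs.
From HB Require Import structures.
From mathcomp Require Import all_boot all_order all_algebra.
From mathcomp Require Import boolp.

Set Implicit Arguments.
Unset Strict Implicit.
Unset Printing Implicit Defensive.

Import GRing.Theory.
Local Open Scope ring_scope.

(** Let [T] be the [i]-th tensor power of [m]. The map [nu : T -> m] sending
    [m1 ⊗ m2 ⊗ ...] to the iterated bracket makes [T] a crossed module over
    [m], with image the [i]-th term of the lower central series. The whole
    point is that [nu] has a finite-dimensional kernel: a surjection of Lie
    algebras with finite-dimensional kernel has a finitely presented source if
    and only if its target is finitely presented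
    ([finite_dim_kernel_presented]).

    The source of finiteness is the classical fact that a map from a finitely
    generated algebra onto a finitely presented one has a kernel which is
    finitely generated as an ideal. It is proved here
    ([finitely_presented_kernel]) for a source [X] which is only a vector space
    with a bilinear bracket, provided that ideals are required to contain all
    the squares [[x, x]] and all the Jacobi sums of [X].

    This is applied to a crossed module [nu : T -> m] whose image has finite
    codimension ([crossed_module_kernel]). Let [C] be a finite-dimensional
    complement of the image. The brackets of [C] in [m] can be lifted to
    [X = C * T], and together with the crossed module structure they define a
    bracket on [X] for which [c + nu t] is a multiplicative map onto [m], with
    kernel [W = ker nu]. In general [X] is not a Lie algebra: the obstruction
    is a class in the third cohomology of [m / nu T] with values in [W]. But all
    its values come from triples in [C], so that they span a finite-dimensional
    space, and this is all that matters. If moreover [m] sends [W] into a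
    finite-dimensional space, then a finitely generated ideal contained in [W]
    is finite-dimensional; hence so is [W].

    It remains to go by induction from a crossed module [N] to [N ⊗ m]
    ([tame_succ]). The action satisfies [x (n ⊗ y) = (y n) ⊗ x], so that every
    [t] has some [n] in [N] with [x t = n ⊗ x] for all [x] and
    [nu n = - nu t] ([act_factors]). In particular [m] sends the kernel on
    [N ⊗ m] into [ker nu ⊗ m], which is finite-dimensional, as [ker nu] is
    finite-dimensional and stable under [m], and as [m] is finitely
    generated. *)

(** * Linear maps, subspaces and finite spans *)
Section Linear.
Variables (K : fieldType) (U V : lmodType K) (f : U -> V).
Hypothesis f_lin : linear f.

Lemma linD x y : f (x + y) = f x + f y.
Proof. by have := f_lin 1 x y; rewrite !scale1r. Qed.
Lemma lin0 : f 0 = 0.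
Proof. by apply: (addrI (f 0)); rewrite -linD !addr0. Qed.
Lemma linZ k x : f (k *: x) = k *: f x.
Proof. by have := f_lin k x 0; rewrite lin0 !addr0. Qed.
Lemma linN x : f (- x) = - f x.
Proof. by rewrite -scaleN1r linZ scaleN1r. Qed.
Lemma linB x y : f (x - y) = f x - f y.
Proof. by rewrite linD linN. Qed.
End Linear.

Section Span.
Variable K : fieldType.
Implicit Types U V W : lmodType K.

Definition subspace V (P : V -> Prop) : Prop :=
  P 0 /\ forall k x y, P x -> P y -> P (k *: x + y).

Inductive lspan V (s : seq V) : V -> Prop :=
| lspan0 : lspan s 0
| lspan_add k x y : x \in s -> lspan s y -> lspan s (k *: x + y).

Section Subspace.
Variables (V : lmodType K) (P : V -> Prop).
Hypothesis P_sub : subspace P.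

Lemma subspace0 : P 0. Proof. by case: P_sub. Qed.
Lemma subspaceZ k x : P x -> P (k *: x).
Proof.
by move=> Px; rewrite -[_ *: _]addr0; apply: P_sub.2 => //; apply: subspace0.
Qed.
Lemma subspaceD x y : P x -> P y -> P (x + y).
Proof. by rewrite -{2}[x]scale1r; apply: P_sub.2. Qed.
Lemma subspaceN x : P x -> P (- x).
Proof. by rewrite -scaleN1r; apply: subspaceZ. Qed.
Lemma subspaceB x y : P x -> P y -> P (x - y).
Proof. by move=> Px Py; apply: subspaceD => //; apply: subspaceN. Qed.
Lemma subspace_sum I (r : seq I) (F : I -> V) :
  (forall i, P (F i)) -> P (\sum_(i <- r) F i).
Proof.
by move=> PF; elim/big_ind: _ => //; [apply: subspace0|apply: subspaceD].
Qed.
Lemma subspace_mod x y : P (x - y) -> P y -> P x.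
Proof. by move=> Pxy Py; rewrite -[x](subrK y); apply: subspaceD. Qed.
End Subspace.

Lemma lspan_sub V (s : seq V) : subspace (lspan s).
Proof.
split=> [|k x y sx sy]; first exact: lspan0.
elim: sx => [|l z x' zs _ IH]; first by rewrite scaler0 add0r.
by rewrite scalerDr scalerA -addrA; apply: lspan_add.
Qed.

Lemma lspan_min V (s : seq V) (P : V -> Prop) x :
  lspan s x -> subspace P -> (forall y, y \in s -> P y) -> P x.
Proof.
move=> sx subP sP; elim: sx => [|k y z ys _ Pz]; first exact: subspace0.
by apply: subP.2 => //; apply: sP.
Qed.

Lemma mem_lspan V (s : seq V) x : x \in s -> lspan s x.
Proof.
by move=> xs; rewrite -[x]addr0 -[x]scale1r; apply: lspan_add => //; apply: lspan0.
Qed.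

Lemma lspan_le V (s s' : seq V) x :
  {subset s <= s'} -> lspan s x -> lspan s' x.
Proof.
move=> ss' sx; elim: sx => [|k y z /ss' ys _ IH]; first exact: lspan0.
exact: lspan_add.
Qed.

Lemma lspan_map U V (g : U -> V) (s : seq U) x :
  linear g -> lspan s x -> lspan (map g s) (g x).
Proof.
move=> g_lin; elim=> [|k y z ys _ IH]; first by rewrite lin0 //; apply: lspan0.
by rewrite g_lin; apply: lspan_add => //; apply: map_f.
Qed.

(** Products of two finite-dimensional spaces are finite-dimensional; used both
    for brackets and for tensors. *)
Lemma lspan_allpairs U V W (b : U -> V -> W) s s' x y :
    (forall v, linear (b^~ v)) -> (forall u, linear (b u)) ->
  lspan s x -> lspan s' y -> lspan (allpairs b s s') (b x y).
Proof.
move=> bl br sx s'y.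
elim: sx => [|k u x' us _ IHx]; first by rewrite (lin0 (bl y)); apply: lspan0.
rewrite bl; apply: (lspan_sub _).2 => //; elim: s'y => [|l v y' vs _ IHy].
  by rewrite (lin0 (br u)); apply: lspan0.
by rewrite br; apply: (lspan_sub _).2 => //; apply/mem_lspan/allpairs_f.
Qed.

Lemma lspan_nil V (x : V) : lspan [::] x -> x = 0.
Proof. by case. Qed.

Lemma lspan_cons V a (s : seq V) x :
  lspan (a :: s) x -> exists k, lspan s (x - k *: a).
Proof.
elim=> [|k y z ys _ [l sz]]; first by exists 0; rewrite scale0r subr0; apply: lspan0.
move: ys; rewrite inE => /predU1P[->|ys].
  by exists (k + l); rewrite scalerDl opprD addrACA subrr add0r.
by exists l; rewrite -addrA; apply: lspan_add.
Qed.

(** A subspace of a finite-dimensional space is finite-dimensional. The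
    generators are moreover found inside the subspace, which turns a bound on a
    kernel into generators of that kernel. *)
Lemma subspace_spanned V (P : V -> Prop) (s : seq V) :
    subspace P -> (forall x, P x -> lspan s x) ->
  exists s', (forall x, x \in s' -> P x) /\ (forall x, P x -> lspan s' x).
Proof.
elim: s P => [|a s IHs] P subP Ps; first by exists [::].
pose P1 x := P x /\ lspan s x.
have subP1 : subspace P1.
  split=> [|k x y [Px sx] [Py sy]]; first by split; [apply: subspace0|apply: lspan0].
  by split; [apply: subP.2|apply: (lspan_sub _).2].
have [s1 [s1P P1s]] := IHs P1 subP1 (fun x => @proj2 _ _).
(* Some [p] in [P] involves [a] or none does; in the first case [p] serves *)
(* to eliminate [a] from all the other vectors of [P]. *)
have [[p [Pp [k [k0 sp]]]]|no] :=
    pselect (exists p, P p /\ exists k, k != 0 /\ lspan s (p - k *: a)); last first.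
  exists s1; split=> [x /s1P[]//|x Px]; apply: P1s; split=> //.
  have [k sx] := lspan_cons (Ps _ Px).
  have [k0|k0] := eqVneq k 0; first by rewrite k0 scale0r subr0 in sx.
  by case: no; exists x; split=> //; exists k.
exists (p :: s1); split=> [x|x Px].
  by rewrite inE => /predU1P[->//|/s1P[]].
have [l sx] := lspan_cons (Ps _ Px).
have spsub := lspan_sub (p :: s1).
have : lspan s1 (x - (l / k) *: p).
  apply: P1s; split; first by apply: subspaceB => //; apply: subspaceZ.
  suff -> : x - (l / k) *: p = (x - l *: a) - (l / k) *: (p - k *: a).
    by have ? := lspan_sub s; apply: subspaceB => //; apply: subspaceZ.
  by rewrite scalerBr scalerA divfK // opprB addrA subrK.
move/(@lspan_le _ _ (p :: s1)) => sx'; apply: (subspace_mod spsub (sx' _)) => [y ys|].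
  by rewrite inE ys orbT.
by apply: subspaceZ => //; apply: mem_lspan; rewrite mem_head.
Qed.

(** A subspace of finite codimension has a finite-dimensional complement, given
    here by a basis modulo [P]. *)
Lemma complement_basis V (P : V -> Prop) (s : seq V) :
    subspace P -> (forall x, exists2 p, P p & lspan s (x - p)) ->
  exists d (c : 'I_d -> V),
    (forall x, exists v : 'rV[K]_d, P (x - \sum_j v 0 j *: c j)) /\
    (forall v : 'rV[K]_d, P (\sum_j v 0 j *: c j) -> v = 0).
Proof.
elim: s P => [|a s IHs] P subP Ps.
  exists 0, (fun _ => 0); split=> [x|v _]; last by apply/rowP => -[].
  exists 0; rewrite big_ord0 subr0; have [p Pp sx] := Ps x.
  suff -> : x = p by [].
  by apply/eqP; rewrite -subr_eq0; apply/eqP/lspan_nil.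
pose P1 x := exists k, P (x - k *: a).
have subP1 : subspace P1.
  split=> [|k x y [l Px] [l' Py]].
    by exists 0; rewrite scale0r subr0; apply: subspace0.
  exists (k * l + l'); rewrite scalerDl -scalerA opprD addrACA -scalerBr.
  exact: subP.2.
have /(IHs _ subP1)[d [c [cs cf]]] x : exists2 p, P1 p & lspan s (x - p).
  have [p Pp /lspan_cons[k sx]] := Ps x.
  exists (p + k *: a); last by rewrite opprD addrA.
  by exists k; rewrite addrK.
(* [c] is a basis modulo [P + <a>]; modulo [P] it must be completed by [a], *)
(* unless [a] is in [P]. *)
have [Pa|nPa] := pselect (P a).
  have P1P x : P1 x -> P x by case=> k /(subspace_mod subP); apply; apply: subspaceZ.
  exists d, c; split=> [x|v Pv]; first by have [v /P1P] := cs x; exists v.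
  by apply: cf; exists 0; rewrite scale0r subr0.
exists d.+1, (fun j => oapp c a (unlift ord0 j)).
have E (v : 'rV[K]_d.+1) :
    \sum_j v 0 j *: oapp c a (unlift ord0 j)
      = v 0 0 *: a + \sum_j (\row_j v 0 (lift ord0 j)) 0 j *: c j.
  rewrite big_ord_recl unlift_none; congr (_ + _).
  by apply: eq_bigr => j _; rewrite liftK mxE.
split=> [x|v].
  have [v [k Pv]] := cs x.
  exists (\row_j oapp (v 0) k (unlift ord0 j)); rewrite E mxE unlift_none /=.
  rewrite (eq_bigr (fun j => v 0 j *: c j)) => [|j _]; last by rewrite !mxE liftK.
  by rewrite opprD addrA addrAC.
rewrite E => Pv.
have v0 : \row_j v 0 (lift ord0 j) = 0.
  by apply: cf; exists (- v 0 0); rewrite scaleNr opprK addrC.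
move: Pv; rewrite v0 big1 => [|j _]; last by rewrite mxE scale0r.
rewrite addr0 => Pv; have v00 : v 0 0 = 0.
  apply/eqP/negP => /negP k0; apply: nPa.
  by rewrite -[a]scale1r -(mulVf k0) -scalerA; apply: subspaceZ.
apply/rowP => j; rewrite mxE; case: (unliftP ord0 j) => [i|] ->//.
by have /rowP/(_ i) := v0; rewrite !mxE.
Qed.

End Span.

(** * Algebras with a bilinear bracket, and ideals with a Lie quotient *)
Section Bracket.
Variables (K : fieldType) (X : lmodType K) (br : X -> X -> X).
Hypothesis br_linl : forall y, linear (br^~ y).
Hypothesis br_linr : forall x, linear (br x).

Definition generates (gs : seq X) : Prop :=
  forall G : X -> Prop, subspace G -> (forall x y, G x -> G y -> G (br x y)) ->
  (forall g, g \in gs -> G g) -> forall x, G x.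

(** As [br] need not satisfy the axioms of a Lie bracket, these are the ideals
    whose quotient is a Lie algebra. *)
Record lie_ideal (I : X -> Prop) : Prop := LieIdeal {
  ideal_sub : subspace I;
  ideal_l : forall x y, I y -> I (br x y);
  ideal_r : forall x y, I x -> I (br x y);
  ideal_sq : forall x, I (br x x);
  ideal_jacobi : forall x y z,
    I (br x (br y z) + br y (br z x) + br z (br x y))
}.

Definition ideal_generates (ks : seq X) (P : X -> Prop) : Prop :=
  forall I, lie_ideal I -> (forall k, k \in ks -> I k) -> forall x, P x -> I x.

Section Eval.
Variables (Y : Type) (f : Y -> X).

(** Evaluation of Lie terms as in [term_eval], but in an algebra in which the
    Lie axioms may fail. *)
Fixpoint br_eval (t : lie_term K Y) : X :=
  match t with
  | LVar y => f y
  | LZero => 0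
  | LOpp a => - br_eval a
  | LAdd a b => br_eval a + br_eval b
  | LScale k a => k *: br_eval a
  | LLie a b => br (br_eval a) (br_eval b)
  end.

(** Evaluation modulo [I] takes place in the Lie algebra [X / I], and so
    respects the congruence; arguing modulo [I] in [X] itself spares the
    construction of that quotient. *)
Lemma br_eval_cong (I : X -> Prop) R a b :
    lie_ideal I -> (forall a b, R a b -> I (br_eval a - br_eval b)) ->
  lie_cong R a b -> I (br_eval a - br_eval b).
Proof.
move=> Ii IR; have Is := ideal_sub Ii.
have Irefl x y : x = y -> I (x - y) by move=> ->; rewrite subrr; apply: subspace0.
elim=> /=.
- exact: IR.
- by move=> *; apply: Irefl.
- by move=> u v _ uv; rewrite -opprB; apply: subspaceN.
- move=> u v w _ uv _ vw; rewrite -(subrK (br_eval v) (br_eval u)) -addrA.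
  exact: subspaceD.
- by move=> u v _ uv; rewrite -opprD; apply: subspaceN.
- by move=> u v w z _ uv _ wz; rewrite opprD addrACA; apply: subspaceD.
- by move=> k u v _ uv; rewrite -scalerBr; apply: subspaceZ.
- move=> u v w z _ uv _ wz.
  rewrite -(subrK (br (br_eval v) (br_eval w)) (br (br_eval u) _)) -addrA.
  rewrite -(linB (br_linl _)) -(linB (br_linr _)).
  by apply: subspaceD => //; [apply: ideal_r|apply: ideal_l].
- by move=> *; apply: Irefl; rewrite addrA.
- by move=> *; apply: Irefl; rewrite addrC.
- by move=> *; apply: Irefl; rewrite add0r.
- by move=> *; apply: Irefl; rewrite addNr.
- by move=> *; apply: Irefl; rewrite scalerA.
- by move=> *; apply: Irefl; rewrite scale1r.
- by move=> *; apply: Irefl; rewrite scalerDr.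
- by move=> *; apply: Irefl; rewrite scalerDl.
- by move=> *; apply: Irefl; rewrite br_linl.
- by move=> *; apply: Irefl; rewrite br_linr.
- by move=> *; rewrite subr0; apply: ideal_sq.
- by move=> *; rewrite subr0; apply: ideal_jacobi.
Qed.
End Eval.

(** The kernel is generated by the relators of [L], evaluated at lifts of its
    generators, and by the differences [g - e (w g)] between each generator of
    [X] and the value at these lifts of a word for its image. Indeed, modulo
    these elements every [x] is the value of a word, and a word that vanishes
    in [L] is trivial by the relations of [L] alone. *)
Lemma finitely_presented_kernel (L : lieType K) (f : X -> L) (gs : seq X) :
    finitely_presented L -> generates gs ->
    linear f -> (forall x y, f (br x y) = [lie f x, f y]) ->
    (forall l, exists x, f x = l) ->
  exists ks : seq X, (forall k, k \in ks -> f k = 0) /\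
    ideal_generates ks (fun x => f x = 0).
Proof.
case=> p [r [phi [phiL [psi phiK psiK]]]] gen f_lin f_br f_surj.
set R := (R in presented R) in phi phiL psi phiK psiK *.
have [y yE] := boolp.choice (fun j => f_surj (phi (pres_gen _ j))).
pose e := br_eval y.
have fe a : f (e a) = phi (pres_class R a).
  elim: a => [j||a IH|a IHa b IHb|k a IH|a IHa b IHb].
  - exact: yE.
  - by rewrite /= lin0 // class0 linear0.
  - by rewrite /= linN // -/(e a) IH classN linearN.
  - by rewrite /= linD // -/(e a) -/(e b) IHa IHb classD linearD.
  - by rewrite /= linZ // -/(e a) IH classZ linearZ.
  - by rewrite /= f_br -/(e a) -/(e b) IHa IHb classL phiL.
pose w g := pres_repr (psi (f g)).
have few g : f (e (w g)) = f g by rewrite fe pres_reprK psiK.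
exists ([seq g - e (w g) | g <- gs] ++ [seq e ab.1 - e ab.2 | ab <- r]).
split=> [k|I Ii Ik].
  rewrite mem_cat => /orP[] /mapP[]; first by move=> g _ ->; rewrite linB // few subrr.
  move=> [a b] rab -> /=; rewrite linB // !fe; apply/eqP; rewrite subr_eq0; apply/eqP.
  by congr (phi _); apply/pres_classP/cong_rel.
have Is := ideal_sub Ii.
have Rcong a b : lie_cong R a b -> I (e a - e b).
  apply: br_eval_cong => // c d cd; apply: Ik.
  by rewrite mem_cat; apply/orP; right; apply/mapP; exists (c, d).
have key : forall x, exists2 a, I (x - e a) & f x = phi (pres_class R a).
  apply: gen.
  - split=> [|k x x' [a xa fa] [a' xa' fa']].
      exists LZero; last by rewrite lin0 // class0 linear0.
      by rewrite /= subrr; apply: subspace0.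
    exists (LAdd (LScale k a) a'); last by rewrite f_lin classD classZ linearP fa fa'.
    by rewrite /= opprD addrACA -scalerBr; apply: Is.2.
  - move=> x x' [a xa fa] [a' xa' fa'].
    exists (LLie a a'); last by rewrite f_br classL phiL fa fa'.
    rewrite /= -(subrK (br (e a) x') (br x x')) -addrA.
    rewrite -(linB (br_linl _)) -(linB (br_linr _)).
    by apply: subspaceD => //; [apply: ideal_r|apply: ideal_l].
  - move=> g gg; exists (w g); last by rewrite -fe few.
    by apply: Ik; rewrite mem_cat; apply/orP; left; apply/mapP; exists g.
move=> x; have [a xa fa] := key x => fx0.
suff Iea : I (e a - e LZero) by apply: (subspace_mod Is xa); rewrite subr0 in Iea.
apply: Rcong; apply/pres_classP; rewrite class0.
by apply: (can_inj phiK); rewrite -fa fx0 linear0.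
Qed.
End Bracket.

(** * Finite presentation and kernels of surjections *)
Section LieFinite.
Variable K : fieldType.
Implicit Types L P G Q : lieType K.

Lemma lie_ideal_intro L (I : L -> Prop) :
  subspace I -> (forall x y, I y -> I [lie x, y]) -> lie_ideal (@lie K L) I.
Proof.
move=> Is Il; split=> // [x y Ix|x|x y z]; last by rewrite lie_jacobi; apply: subspace0.
  by rewrite lieC; apply: subspaceN => //; apply: Il.
by rewrite liexx; apply: subspace0.
Qed.

(** The elements of [L] that send [I] into itself form a subalgebra. *)
Lemma generated_ideal L (gs : seq L) (I : L -> Prop) :
    generates (@lie K L) gs -> subspace I ->
    (forall g y, g \in gs -> I y -> I [lie g, y]) ->
  forall x y, I y -> I [lie x, y].
Proof.
move=> gen Is Ig; apply: (gen (fun x => forall y, I y -> I [lie x, y])) => //.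
- split=> [y _|k x x' Ix Ix' y Iy]; first by rewrite lie0l; apply: subspace0.
  by rewrite lieDl lieZl; apply: Is.2; [apply: Ix|apply: Ix'].
- move=> x x' Ix Ix' y Iy; rewrite lie_liel.
  by apply: subspaceB => //; [apply/Ix/Ix'|apply/Ix'/Ix].
- by move=> g gg y; apply: Ig.
Qed.

Lemma presented_generates n (R : lie_term K 'I_n -> lie_term K 'I_n -> Prop) :
  generates (@lie K (presented R)) [seq pres_gen R j | j : 'I_n].
Proof.
move=> H Hs Hl Hg; apply: pres_ind.
- exact: subspace0.
- by move=> j; apply: Hg; apply/map_f; rewrite mem_enum.
- by move=> *; apply: subspaceD.
- by move=> *; apply: subspaceZ.
- exact: Hl.
Qed.

Lemma generates_map L L' (f : L -> L') gs :
    linear f -> (forall x y, f [lie x, y] = [lie f x, f y]) ->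
    (forall y, exists x, f x = y) ->
  generates (@lie K L) gs -> generates (@lie K L') (map f gs).
Proof.
move=> fl fb fs gen H Hs Hl Hg y; have [x <-] := fs y.
apply: (gen (fun x => H (f x))) => [|u v Hu Hv|g gg].
- split=> [|k u v Hu Hv]; first by rewrite lin0 //; apply: subspace0.
  by rewrite fl; apply: Hs.2.
- by rewrite fb; apply: Hl.
- exact/Hg/map_f.
Qed.

Lemma finitely_presented_generated L :
  finitely_presented L -> exists gs : seq L, generates (@lie K L) gs.
Proof.
case=> n [r [phi [phiL [psi _ psiK]]]].
eexists; apply: (generates_map _ phiL _ (@presented_generates _ _)).
  exact: linearP.
by move=> y; exists (psi y).
Qed.

Lemma lie_isomorphic_intro L L' (f : L -> L') :
    linear f -> (forall x y, f [lie x, y] = [lie f x, f y]) ->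
    (forall x, f x = 0 -> x = 0) -> (forall y, exists x, f x = y) ->
  lie_isomorphic L L'.
Proof.
move=> fl fb f0 fs.
pose F : {linear L -> L'} := HB.pack f (GRing.isLinear.Build K L L' *:%R f fl).
exists F; split=> //; have [g gK] := boolp.choice fs.
have fK : cancel f g.
  move=> x; apply/eqP; rewrite -subr_eq0; apply/eqP/f0.
  by rewrite linB // gK subrr.
by exists g.
Qed.

Lemma term_eval_hom (Y : Type) (R : lie_term K Y -> lie_term K Y -> Prop) L
    (F : presented R -> L) a :
    linear F -> (forall x y, F [lie x, y] = [lie F x, F y]) ->
  term_eval (fun y => F (pres_gen R y)) a = F (pres_class R a).
Proof.
move=> Fl Fb; elim: a => [j||a IH|a IHa b IHb|k a IH|a IHa b IHb] /=.
- by [].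
- by rewrite class0 lin0.
- by rewrite IH classN linN.
- by rewrite IHa IHb classD linD.
- by rewrite IH classZ linZ.
- by rewrite IHa IHb classL Fb.
Qed.

(** Adding to a presentation of [P] one relator for each of the generators [ks]
    of the kernel gives a presentation of [L]. *)
Lemma finitely_presented_quotient P L (f : P -> L) (ks : seq P) :
    finitely_presented P ->
    linear f -> (forall x y, f [lie x, y] = [lie f x, f y]) ->
    (forall y, exists x, f x = y) ->
    (forall k, k \in ks -> f k = 0) ->
    ideal_generates (@lie K P) ks (fun x => f x = 0) ->
  finitely_presented L.
Proof.
case=> n [r [phi [phiL [psi phiK psiK]]]] fl fb fs fk fgen.
pose t k := pres_repr (psi k).
pose r' := r ++ [seq (t k, LZero) | k <- ks].
pose R' a b := is_true ((a, b) \in r').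
pose h j := f (phi (pres_gen _ j)).
have hE a : term_eval h a = f (phi (pres_class _ a)).
  apply: (@term_eval_hom _ _ _ (fun x => f (phi x))) => [k x y|x y].
    by rewrite linearP fl.
  by rewrite phiL fb.
have hR a b : R' a b -> term_eval h a = term_eval h b.
  rewrite /R' mem_cat => /orP[rab|/mapP[k kks [-> ->]]].
    by rewrite !hE; congr (f (phi _)); apply/pres_classP/cong_rel.
  by rewrite !hE pres_reprK psiK class0 linear0 lin0 // fk.
have QR a b : (a, b) \in r ->
    term_eval (pres_gen R') a = term_eval (pres_gen R') b.
  have E c := @term_eval_hom _ R' _ id c (fun _ _ _ => erefl) (fun _ _ => erefl).
  by move=> rab; rewrite !E; apply/pres_classP/cong_rel; rewrite /R' mem_cat rab.
exists n, r'; apply: (@lie_isomorphic_intro _ _ (pres_lift h)).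
- exact: pres_lift_linear.
- exact: pres_lift_lie.
- move=> x; rewrite -[x]pres_reprK pres_lift_class //; move: (pres_repr x) => a.
  rewrite hE => ha0.
  (* The kernel of the quotient map from [P] to the algebra presented by [r'] *)
  (* is an ideal containing [ks]. *)
  pose J x := pres_lift (pres_gen R') (psi x) = 0.
  have psil : linear psi.
    move=> k u v; apply: (can_inj phiK).
    by rewrite psiK linearP !psiK.
  have psib u v : psi [lie u, v] = [lie psi u, psi v].
    by apply: (can_inj phiK); rewrite psiK phiL !psiK.
  have gl := pres_lift_linear QR; have gb := pres_lift_lie QR.
  suff : J (phi (pres_class _ a)).
    rewrite /J phiK pres_lift_class // => <-.
    exact/esym/(@term_eval_hom _ _ _ id).
  apply: fgen ha0 => [|k kks].
    apply: lie_ideal_intro => [|u v Jv]; last by rewrite /J psib gb Jv lie0r.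
    split=> [|k u v Ju Jv]; first by rewrite /J !lin0.
    by rewrite /J psil gl Ju Jv scaler0 addr0.
  rewrite /J -[psi k]pres_reprK pres_lift_class // (@term_eval_hom _ _ _ id) //.
  rewrite -class0; apply/pres_classP/cong_rel; rewrite /R' mem_cat.
  by apply/orP; right; apply/mapP; exists k.
- move=> y; have [x <-] := fs y; exists (pres_class R' (pres_repr (psi x))).
  by rewrite pres_lift_class // hE pres_reprK psiK.
Qed.

Lemma extension_generated G Q (f : G -> Q) (a : seq G) (qs : seq Q) :
    linear f -> (forall x y, f [lie x, y] = [lie f x, f y]) ->
    (forall y, exists x, f x = y) -> (forall x, f x = 0 -> lspan a x) ->
  generates (@lie K Q) qs -> exists gs, generates (@lie K G) gs.
Proof.
move=> fl fb fs ka qgen; have [g gK] := boolp.choice fs.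
exists (map g qs ++ a) => H Hs Hl Hgs.
have im : forall q, exists2 x, H x & f x = q.
  apply: qgen => [|_ _ [x Hx <-] [y Hy <-]|q qq].
  - split=> [|k _ _ [x Hx <-] [y Hy <-]].
      by exists 0; [apply: subspace0|apply: lin0].
    by exists (k *: x + y); [apply: Hs.2|apply: fl].
  - by exists [lie x, y]; [apply: Hl|apply: fb].
  - by exists (g q); [apply: Hgs; rewrite mem_cat map_f|apply: gK].
move=> y; have [x Hx fx] := im (f y); apply: (subspace_mod Hs (y := x)) => //.
have /lspan_min : lspan a (y - x) by apply: ka; rewrite linB // fx subrr.
by apply=> // z za; apply: Hgs; rewrite mem_cat za orbT.
Qed.

Definition free_rel n (u v : lie_term K 'I_n) : Prop := (u, v) \in [::].

Lemma finitely_presented_free n : finitely_presented (presented (@free_rel n)).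
Proof.
by exists n, [::]; apply: (@lie_isomorphic_intro _ _ id) => // y; exists y.
Qed.

Lemma free_cover G (gs : seq G) : generates (@lie K G) gs ->
  exists n (h : presented (@free_rel n) -> G),
    [/\ linear h, forall x y, h [lie x, y] = [lie h x, h y] &
        forall y, exists x, h x = y].
Proof.
move=> ggen; pose n := size gs; pose e (j : 'I_n) := gs`_j.
have eR u v : free_rel u v -> term_eval e u = term_eval e v by [].
have hl := pres_lift_linear eR; have hb := pres_lift_lie eR.
exists n, (pres_lift e); split=> //.
apply: ggen => [|_ _ [x <-] [y <-]|g /(nthP 0)[j jn <-]].
- split=> [|k _ _ [x <-] [y <-]]; first by exists 0; rewrite lin0.
  by exists (k *: x + y); rewrite hl.
- by exists [lie x, y]; rewrite hb.
- by exists (pres_gen _ (Ordinal jn)); rewrite pres_lift_gen.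
Qed.

(** Downwards, any finite family spanning the kernel generates it. Upwards, let
    [h] map a free algebra [P] of finite rank onto [G], and let [a'] be lifts of
    a finite family spanning [ker f]. The kernel of [f h] is generated by a finite list [ks],
    and each of its elements is congruent modulo [ker h] to one in the span of
    [a']. Killing the differences for [ks] and for the brackets of generators
    of [P] with [a'] makes the span of [a'] an ideal equal to the image of
    [ker (f h)]; there only remain to kill the elements of [ker h] which lie in
    the span of [a'], and these form a finite-dimensional space. *)
Lemma finite_dim_kernel_presented G Q (f : G -> Q) (s : seq G) :
    linear f -> (forall x y, f [lie x, y] = [lie f x, f y]) ->
    (forall y, exists x, f x = y) -> (forall x, f x = 0 -> lspan s x) ->
  finitely_presented G <-> finitely_presented Q.
Proof.
move=> fl fb fs fk.
have subk : subspace (fun x => f x = 0).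
  split=> [|k x y fx fy]; first exact: lin0.
  by rewrite fl fx fy scaler0 addr0.
have [a [ak ka]] := subspace_spanned subk fk.
split=> [Gfp|Qfp].
  apply: (finitely_presented_quotient Gfp fl fb fs ak) => I Ii Ia x /ka ax.
  exact: (lspan_min ax (ideal_sub Ii) Ia).
have [qs qgen] := finitely_presented_generated Qfp.
have [gs ggen] := extension_generated fl fb fs ka qgen.
have [n [h [hl hb hs]]] := free_cover ggen.
set P := presented _ in h hl hb hs.
have Pfp : finitely_presented P := finitely_presented_free n.
have [] := @finitely_presented_kernel K P (@lie K P) (@lie_linearl K P)
  (@lie_linearr K P) Q (fun x => f (h x)) _ Qfp (@presented_generates _ _).
- by move=> k x y; rewrite hl fl.
- by move=> x y; rewrite hb fb.
- by move=> y; have [x <-] := fs y; have [z <-] := hs x; exists z.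
move=> ks [kk kgen].
have [h' h'K] := boolp.choice hs.
pose a' := map h' a.
have [u uP] : exists u : P -> P, forall x, f (h x) = 0 ->
    lspan a' (u x) /\ h (x - u x) = 0.
  have: forall x, exists y, f (h x) = 0 -> lspan a' y /\ h (x - y) = 0.
    move=> x; have [fhx|] := pselect (f (h x) = 0); last by exists 0.
    have [y [ay hy]] : exists y, lspan a' y /\ h y = h x.
      elim: (ka _ fhx) => [|k y z ya _ [z' [a'z hz']]].
        by exists 0; rewrite (lin0 hl); split=> //; apply: lspan0.
      exists (k *: h' y + z'); rewrite hl h'K hz'; split=> //.
      by apply: lspan_add => //; apply: map_f.
    by exists y => _; rewrite linB // hy subrr.
  by move/boolp.choice => [u uP]; exists u.
have [rho [rhoR Rrho]] : exists rho : seq P,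
    (forall x, x \in rho -> h x = 0 /\ lspan a' x) /\
    (forall x, h x = 0 /\ lspan a' x -> lspan rho x).
  apply: (@subspace_spanned _ _ _ a') => [|x []//].
  split=> [|k x y [hx ax] [hy ay]]; first by split; [exact: lin0|exact: lspan0].
  by split; [rewrite hl hx hy scaler0 addr0|apply: (lspan_sub _).2].
pose xs : seq P := [seq pres_gen _ j | j : 'I_n].
pose cs := [seq [lie x, z] | x <- xs, z <- a'].
pose rs := rho ++ [seq k - u k | k <- ks ++ cs].
have fha x : lspan a' x -> f (h x) = 0.
  elim=> [|k y z /mapP[b ba ->] _ IH]; first by rewrite !lin0.
  by rewrite hl fl IH h'K ak // scaler0 addr0.
have fhk k : k \in ks ++ cs -> f (h k) = 0.
  rewrite mem_cat => /orP[/kk //|/allpairsP[[x z] [_ za' ->]]] /=.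
  by rewrite hb fb (fha z) ?lie0r //; apply: mem_lspan.
apply: (finitely_presented_quotient (ks := rs) Pfp hl hb hs).
  move=> k; rewrite mem_cat => /orP[/rhoR[]//|/mapP[z /fhk /uP[_ hz] ->]] //.
move=> I0 I0i I0r.
(* Cutting [I0] down to [ker h] makes the components in the span of [a'] of *)
(* elements of [ker h] remain in [ker h]. *)
pose I x := I0 x /\ h x = 0.
have I0s := ideal_sub I0i.
have Is : subspace I.
  split=> [|k x y [Ix hx] [Iy hy]]; first by split; [exact: subspace0|exact: lin0].
  by split; [apply: I0s.2|rewrite hl hx hy scaler0 addr0].
have Il x y : I y -> I [lie x, y].
  by case=> Iy hy; split; [apply: (ideal_l I0i)|rewrite hb hy lie0r].
have Ik k : k \in ks ++ cs -> I (k - u k).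
  move=> kk'; split; last by case: (uP _ (fhk _ kk')).
  by apply: I0r; rewrite mem_cat (map_f (fun k => k - u k)) ?orbT.
pose S x := exists2 v, lspan a' v & I (x - v).
have Ss : subspace S.
  split=> [|k x y [v av Ixv] [w aw Iyw]].
    by exists 0; [apply: lspan0|rewrite subr0; apply: subspace0].
  exists (k *: v + w); first exact: (lspan_sub _).2.
  by rewrite opprD addrACA -scalerBr; apply: Is.2.
have SI x : I x -> S x by exists 0; [apply: lspan0|rewrite subr0].
have Sk k : k \in ks ++ cs -> S k.
  by move=> kk'; exists (u k); [case: (uP _ (fhk _ kk'))|apply: Ik].
have Sl : forall x y, S y -> S [lie x, y].
  apply: (generated_ideal (@presented_generates _ _)) => // x y xx [v av Ixv].
  apply: (subspace_mod Ss (y := [lie x, v])); first by rewrite -lieBr; apply/SI/Il.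
  elim: av => [|k z w za _ IH]; first by rewrite lie0r; apply: subspace0.
  rewrite lieDr lieZr; apply: Ss.2 => //; apply: Sk.
  by rewrite mem_cat; apply/orP; right; apply: allpairs_f.
move=> x hx; have [v av [Ixv hxv]] : S x.
  apply: kgen; [|by move=> k kk'; apply: Sk; rewrite mem_cat kk'|by rewrite hx lin0].
  exact: lie_ideal_intro.
apply: (subspace_mod I0s Ixv).
have : lspan rho v.
  apply: Rrho; split=> //; move: hxv; rewrite linB // hx sub0r.
  by move/eqP; rewrite oppr_eq0 => /eqP.
move/lspan_min; apply=> // z zr; apply: I0r.
by rewrite mem_cat zr.
Qed.

End LieFinite.

(** * An almost Lie algebra attached to a crossed module *)

(** The cancellation behind the Jacobi identity of a semidirect product: for
    [x = (X, t)], [y = (Y, t')], [z = (Z, t'')], the letters [a], [b], [c] stand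
    for the twofold actions whose last step is by [X], [Y], [Z], the letters
    [p], [q], [r] for the brackets of one component with another one acted upon
    by [X], [Y], [Z], and the [j] for the twofold brackets. *)
Fact cyclic_cancel (V : zmodType)
    (a1 a2 b1 b2 c1 c2 p1 p2 q1 q2 r1 r2 j1 j2 j3 : V) :
    j1 + j2 + j3 = 0 ->
  (a1 - a2 + (- p1 + p2) - (b1 - c2) + (q1 - r2 + j1))
  + (b1 - b2 + (- q1 + q2) - (c1 - a2) + (r1 - p2 + j2))
  + (c1 - c2 + (- r1 + r2) - (a1 - b2) + (p1 - q2 + j3)) = 0.
Proof.
move=> J; rewrite !opprB !addrA.
rewrite [LHS](ACl ((1*24)*(4*17)*(5*20)*(7*12)*(10*6)*(13*26)*(14*2)*(16*21)*
  (19*15)*(23*11)*(22*8)*(25*3)*(9*18*27))) /=.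
by rewrite !(addrN, addNr, add0r).
Qed.

(** That [nu] is a morphism of Lie algebras follows from these axioms; see
    [cm_lie]. *)
Record crossed_module (K : fieldType) (m T : lieType K) (a : lie_action m T)
    (nu : T -> m) : Prop := CrossedModule {
  cm_linear : linear nu;
  cm_equivariant : forall x t, nu (a x t) = [lie x, nu t];
  cm_peiffer : forall t t', a (nu t) t' = [lie t, t']
}.

Lemma lin_sum (K : fieldType) (U V : lmodType K) (f : U -> V) I (r : seq I) F :
  linear f -> f (\sum_(i <- r) F i) = \sum_(i <- r) f (F i).
Proof.
move=> fl; elim: r => [|i r IH]; first by rewrite !big_nil lin0.
by rewrite !big_cons linD // IH.
Qed.

Lemma combination_linear (K : fieldType) (V : lmodType K) d (F : 'I_d -> V) :
  linear (fun v : 'rV[K]_d => \sum_j v 0 j *: F j).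
Proof.
move=> k u v; rewrite scaler_sumr -big_split; apply: eq_bigr => j _ /=.
by rewrite !mxE scalerDl scalerA.
Qed.

Lemma pairE (K : fieldType) (U V : lmodType K) (x : U * V) : x = (x.1, 0) + (0, x.2).
Proof. by case: x => u v; congr (_, _); rewrite /= ?addr0 ?add0r. Qed.

Section Cover.
Variables (K : fieldType) (m T : lieType K) (a : lie_action m T) (nu : T -> m).
Hypothesis cm : crossed_module a nu.
Variables (d : nat) (c : 'I_d -> m).

(* In the application [c] is a basis of a complement of the image of [nu]. *)
Let X : lmodType K := ('rV[K]_d * T)%type.
Let iota (v : 'rV[K]_d) : m := \sum_j v 0 j *: c j.

Definition cover_map (x : X) : m := iota x.1 + nu x.2.

Variable w : 'I_d -> 'I_d -> X.
Hypothesis wE : forall j k, cover_map (w j k) = [lie c j, c k].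

(** The bracket of two elements of the complement, lifted to [X] bilinearly
    from a choice [w] on pairs of basis vectors. *)
Definition cover_cocycle (u v : 'rV[K]_d) : X :=
  \sum_j u 0 j *: \sum_k v 0 k *: w j k.

Definition cover_bracket (x y : X) : X :=
  cover_cocycle x.1 y.1
    + (0, a (iota x.1) y.2 - a (iota y.1) x.2 + [lie x.2, y.2]).

Let nul := cm_linear cm.
Let iotal : linear iota := combination_linear c.

Lemma cover_map_linear : linear cover_map.
Proof.
by move=> k x y; rewrite /cover_map /= iotal nul scalerDr addrACA.
Qed.

Lemma cover_cocycle_linl v : linear (cover_cocycle^~ v).
Proof. exact: combination_linear. Qed.

Lemma cover_cocycle_linr u : linear (cover_cocycle u).
Proof.
move=> k v v'; rewrite /cover_cocycle scaler_sumr -big_split.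
apply: eq_bigr => j _; rewrite /= combination_linear scalerDr !scalerA.
by rewrite [k * _]mulrC.
Qed.

Lemma cover_map_cocycle u v : cover_map (cover_cocycle u v) = [lie iota u, iota v].
Proof.
rewrite [in RHS]/iota (lin_sum _ _ (lie_linearl _)) (lin_sum _ _ cover_map_linear).
apply: eq_bigr => j _; rewrite lieZl (linZ cover_map_linear); congr (_ *: _).
rewrite (lin_sum _ _ (lie_linearr _)) (lin_sum _ _ cover_map_linear).
by apply: eq_bigr => k _; rewrite lieZr (linZ cover_map_linear) wE.
Qed.

Lemma cm_lie t t' : nu [lie t, t'] = [lie nu t, nu t'].
Proof. by rewrite -(cm_peiffer cm) (cm_equivariant cm). Qed.

Lemma cover_map_bracket x y :
  cover_map (cover_bracket x y) = [lie cover_map x, cover_map y].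
Proof.
rewrite (linD cover_map_linear) cover_map_cocycle [X in _ + X]/cover_map /=.
rewrite (lin0 iotal) add0r (linD nul) (linB nul) !(cm_equivariant cm) cm_lie.
rewrite [X in _ - X]lieC opprK /cover_map !(lieDl, lieDr) !addrA.
by congr (_ + _); rewrite addrAC.
Qed.

Lemma cover_bracket_linl y : linear (cover_bracket^~ y).
Proof.
move=> k x x'; rewrite /cover_bracket /= cover_cocycle_linl scalerDr addrACA.
congr (_ + _); congr (_, _); first by rewrite /= scaler0 addr0.
rewrite /= iotal actDl actZl actDr actZr lieDl lieZl !(scalerDr, scalerN) !opprD.
by rewrite !addrA [LHS](ACl (1*3*5*2*4*6)).
Qed.

Lemma cover_bracket_linr x : linear (cover_bracket x).
Proof.
move=> k y y'; rewrite /cover_bracket /= cover_cocycle_linr scalerDr addrACA.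
congr (_ + _); congr (_, _); first by rewrite /= scaler0 addr0.
rewrite /= iotal actDl actZl actDr actZr lieDr lieZr !(scalerDr, scalerN) !opprD.
by rewrite !addrA [LHS](ACl (1*3*5*2*4*6)).
Qed.

Lemma cover_bracket_sq x : cover_bracket x x = cover_cocycle x.1 x.1.
Proof. by rewrite /cover_bracket subrr liexx !addr0. Qed.

(** By the Peiffer identity, bracketing with [T] is acting through
    [cover_map]; so on [ker nu] the bracket is the action of [m]. *)
Lemma cover_bracket_r y t : cover_bracket y (0, t) = (0, a (cover_map y) t).
Proof.
rewrite /cover_bracket /= (lin0 (cover_cocycle_linr _)) add0r (lin0 iotal).
by rewrite act0l subr0 -(cm_peiffer cm) -actDl.
Qed.

Lemma cover_bracket_kerl t y :
  nu t = 0 -> cover_bracket (0, t) y = (0, - a (iota y.1) t).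
Proof.
move=> t0; rewrite /cover_bracket /= (lin0 (cover_cocycle_linl _)) add0r.
by rewrite (lin0 iotal) act0l sub0r -(cm_peiffer cm) t0 act0l addr0.
Qed.

(** The part of a double bracket that behaves as in the semidirect product of
    [m] and [T]. *)
Let defect x y z : T :=
  let r := a (iota y.1) z.2 - a (iota z.1) y.2 + [lie y.2, z.2] in
  a (iota x.1) r - a [lie iota y.1, iota z.1] x.2 + [lie x.2, r].

Lemma cover_bracket2 x y z : cover_bracket x (cover_bracket y z) =
  cover_bracket (x.1, 0) (cover_cocycle y.1 z.1) + (0, defect x y z).
Proof.
rewrite {2}/cover_bracket; set o := cover_cocycle y.1 z.1.
rewrite /defect; set r := _ + [lie y.2, z.2].
rewrite (linD (cover_bracket_linr _)) {2}/cover_bracket /=.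
rewrite (lin0 (cover_cocycle_linr _)) add0r (lin0 iotal) act0l subr0.
rewrite /cover_bracket /= lie0l act0r subr0 addr0 -!addrA; congr (_ + _).
congr (_, _); rewrite /= ?addr0 //.
rewrite -(cover_map_cocycle y.1 z.1) -/o actDl (cm_peiffer cm).
rewrite [[lie o.2, _]]lieC opprD opprK.
by rewrite !addrA [LHS](ACl (1*4*2*3*5)).
Qed.

(** The Jacobi sum depends only on the components in the finite-dimensional
    complement. *)
Lemma cover_bracket_jacobi x y z :
  cover_bracket x (cover_bracket y z) + cover_bracket y (cover_bracket z x)
    + cover_bracket z (cover_bracket x y) =
  cover_bracket (x.1, 0) (cover_cocycle y.1 z.1)
    + cover_bracket (y.1, 0) (cover_cocycle z.1 x.1)
    + cover_bracket (z.1, 0) (cover_cocycle x.1 y.1).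
Proof.
rewrite !cover_bracket2 [Y in Y + _]addrACA [LHS]addrACA.
suff cyc : defect x y z + defect y z x + defect z x y = 0.
  rewrite [Y in _ + Y](_ : _ = 0) ?addr0 //.
  by apply: injective_projections; rewrite /= ?addr0.
rewrite /defect; case: x y z => [u t] [u' t'] [u'' t''] /=.
rewrite !(actDr, actNr, lieDr, lieNr, act_lier, act_liel).
rewrite [[lie a (iota u) t', t'']]lieC [[lie a (iota u') t'', t]]lieC.
rewrite [[lie a (iota u'') t, t']]lieC.
exact/cyclic_cancel/lie_jacobi.
Qed.

End Cover.

(** The hypotheses say in turn that the image of [nu] has finite codimension,
    that [m] sends [ker nu] into a finite-dimensional space, and that the
    coinvariants [T / m T] are finite-dimensional; the latter is what makes the
    algebra [X] finitely generated. *)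
Lemma crossed_module_kernel (K : fieldType) (m T : lieType K)
    (a : lie_action m T) (nu : T -> m) (cs : seq m) (sB ts : seq T) :
    finitely_presented m -> crossed_module a nu ->
    (forall x, exists t, lspan cs (x - nu t)) ->
    (forall x t, nu t = 0 -> lspan sB (a x t)) ->
    (forall P : T -> Prop, subspace P -> (forall x t, P (a x t)) ->
      (forall t, t \in ts -> P t) -> forall t, P t) ->
  exists s, forall t, nu t = 0 -> lspan s t.
Proof.
move=> mfp cm csP sBP tsP; have nul := cm_linear cm.
pose im x := exists t, nu t = x.
have ims : subspace im.
  split=> [|k _ _ [x <-] [y <-]]; first by exists 0; rewrite lin0.
  by exists (k *: x + y); rewrite nul.
have [|d [c [cP cfree]]] := complement_basis (s := cs) ims.
  by move=> x; have [t ct] := csP x; exists (nu t) => //; exists t.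
pose X : lmodType K := ('rV[K]_d * T)%type.
pose f : X -> m := cover_map nu c.
have fl : linear f := cover_map_linear cm c.
have fsurj y : exists x, f x = y.
  have [v [t /eqP]] := cP y; rewrite eq_sym subr_eq addrC => /eqP ->.
  by exists (v, t).
have [g gK] := boolp.choice fsurj.
pose w j k : X := g [lie c j, c k].
have wE j k : cover_map nu c (w j k) = [lie c j, c k] by apply: gK.
pose br := cover_bracket a c w.
have brl : forall y, linear (br^~ y) := cover_bracket_linl a c w.
have brr : forall x, linear (br x) := cover_bracket_linr a c w.
have br0 y t : br y (0, t) = (0, a (f y) t) by exact: (cover_bracket_r cm).
have fb x y : f (br x y) = [lie f x, f y] by exact: (cover_map_bracket cm wE).
have kerE x : f x = 0 -> x = (0, x.2) /\ nu x.2 = 0.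
  move=> fx; have x1 : x.1 = 0.
    apply: cfree; exists (- x.2); rewrite linN //; apply/eqP.
    by rewrite eq_sym -addr_eq0; apply/eqP.
  split; first by rewrite -x1; case: (x).
  by move: fx; rewrite /f /cover_map x1 (lin0 (combination_linear c)) add0r.
have incl : linear (fun t => (0, t) : X).
  by move=> k t t'; congr (_, _); rewrite /= scaler0 addr0.
pose es : seq X := [seq (delta_mx 0 j, 0) | j : 'I_d].
have esP v : lspan es (v, 0).
  have sE := lspan_sub es.
  have -> : ((v, 0) : X) = \sum_j v 0 j *: (delta_mx 0 j, 0).
    rewrite {1}[v]row_sum_delta.
    have E : linear (fun u => (u, 0) : X).
      by move=> k u u'; congr (_, _); rewrite /= scaler0 addr0.
    rewrite (lin_sum _ _ E); apply: eq_bigr => j _; exact: (linZ E).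
  apply: subspace_sum => // j; apply: subspaceZ => //; apply: mem_lspan.
  by apply: map_f; rewrite mem_enum.
have [ms mgen] := finitely_presented_generated mfp.
pose sX : seq X := [seq (0, t) | t <- sB].
have sXP x t : nu t = 0 -> lspan sX (0, a x t).
  by move=> t0; apply: lspan_map => //; apply: sBP.
pose gs : seq X := es ++ map g ms ++ [seq (0, t) | t <- ts] ++ sX.
have gen : generates br gs.
  move=> G Gs Gb Ggs.
  have Gsub s x : {subset s <= gs} -> lspan s x -> G x.
    by move=> sgs /lspan_min; apply=> // y /sgs; apply: Ggs.
  have im_f : forall y, exists2 x, G x & f x = y.
    apply: mgen => [|_ _ [x Gx <-] [y Gy <-]|y ym].
    - split=> [|k _ _ [x Gx <-] [y Gy <-]].
        by exists 0; [apply: subspace0|apply: lin0].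
      by exists (k *: x + y); [apply: Gs.2|apply: fl].
    - by exists (br x y); [apply: Gb|apply: fb].
    - exists (g y); last exact: gK.
      by apply: Ggs; rewrite !mem_cat (map_f g ym) orbT.
  (* As [G] maps onto [m], an element [x t] is a bracket of elements of [G] *)
  (* up to the bracket with an element of the kernel, hence up to [sX]. *)
  have GT : forall t, G (0, t).
    apply: tsP => [|x t|t tt].
    - split=> [|k t t' Gt Gt']; first exact: (subspace0 Gs).
      by rewrite incl; apply: Gs.2.
    - have [y Gy fy] := im_f x; have [h Gh fh] := im_f (f (0, t)).
      have [] := kerE ((0, t) - h); first by rewrite (linB fl) fh subrr.
      set z := _.2 => zE z0.
      rewrite -fy -br0 -[(0, t)](subrK h) zE (linD (brr _)) br0.
      apply: subspaceD => //; last exact: Gb.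
      apply: (Gsub sX); last exact: sXP.
      by move=> u us; rewrite !mem_cat us !orbT.
    - apply: Ggs; rewrite !mem_cat.
      by apply/orP; right; apply/orP; right; apply/orP; left; apply: map_f.
  move=> x; rewrite [x]pairE; apply: subspaceD => //.
  by apply: Gsub (esP _) => u us; rewrite mem_cat us.
have [ks [kk0 kgen]] := finitely_presented_kernel brl brr mfp gen fl fb fsurj.
pose ws : seq X := [seq w j k | j <- enum 'I_d, k <- enum 'I_d].
have wsP u v : lspan ws (cover_cocycle w u v).
  have sw := lspan_sub ws.
  apply: subspace_sum => // j; apply: subspaceZ => //; apply: subspace_sum => // k.
  apply: subspaceZ => //; apply: mem_lspan.
  by apply: allpairs_f; rewrite mem_enum.
pose S : seq X := ws ++ allpairs br es ws ++ sX ++ ks.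
have SP s x : {subset s <= S} -> lspan s x -> lspan S x by exact: lspan_le.
have Ss := lspan_sub S.
(* [S] spans the defects of the Lie axioms, the brackets of [X] with the *)
(* kernel, and the generators [ks] of the kernel. *)
pose I x := f x = 0 /\ lspan S x.
have sXS : {subset sX <= S} by move=> u us; rewrite !mem_cat us !orbT.
have Ii : lie_ideal br I.
  split.
  - split=> [|k x y [fx Sx] [fy Sy]]; first by split; [apply: lin0|apply: subspace0].
    by split; [rewrite fl fx fy scaler0 addr0|apply: Ss.2].
  - move=> x y [fy _]; split; first by rewrite fb fy lie0r.
    by have [-> /sXP yX] := kerE _ fy; rewrite br0; apply: (SP sX).
  - move=> x y [fx _]; split; first by rewrite fb fx lie0l.
    have [-> x0] := kerE _ fx; rewrite /br (cover_bracket_kerl cm) //.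
    by rewrite -actNl; apply: (SP sX) => //; apply: sXP.
  - move=> x; split; first by rewrite fb liexx.
    rewrite /br cover_bracket_sq; apply: (SP ws) => // u us.
    by rewrite mem_cat us.
  - move=> x y z; split; first by rewrite 2!(linD fl) !fb lie_jacobi.
    have B u v v' : lspan S (br (u, 0) (cover_cocycle w v v')).
      apply: (SP (allpairs br es ws)); last exact: lspan_allpairs.
      by move=> b bb; rewrite !mem_cat bb !orbT.
    rewrite (cover_bracket_jacobi cm wE).
    by apply: subspaceD; [exact: Ss|apply: subspaceD|apply: B]; rewrite //; apply: B.
exists (map snd S) => t t0.
have ft : f (0, t) = 0.
  by rewrite /f /cover_map /= (lin0 (combination_linear c)) add0r.
have Ik k : k \in ks -> I k.
  move=> kk; split; first exact: kk0.
  by apply: mem_lspan; rewrite !mem_cat kk !orbT.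
have [_ St] := kgen I Ii Ik _ ft.
exact: (lspan_map (g := snd) _ St).
Qed.

(** * Tensor powers *)
Section TensorPower.
Variables (K : fieldType) (m : lieType K).

Lemma compatible_crossed_tensor (N : compatible_pair m) :
  crossed_module (tensor_actl (pair_compat N))
    (@tensor_nu _ _ _ (pair_actl N) (pair_actr N)).
Proof.
split.
- exact: (tensor_nu_linear (pair_compat N)).
- exact: tensor_nu_equivariant.
- exact: tensor_peiffer.
Qed.

(** The data carried along the induction on tensor powers. Finiteness of the
    cokernel and of the coinvariants are the hypotheses of
    [crossed_module_kernel] that do not follow from the finiteness of the
    kernel at the preceding step. *)
Record tame (N : compatible_pair m) (nu : N -> m) : Prop := Tame {
  tame_crossed : crossed_module (pair_actr N) nu;
  tame_act : forall n x, pair_actl N n x = [lie nu n, x];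
  tame_kernel : exists s, forall n, nu n = 0 -> lspan s n;
  tame_cokernel : exists cs, forall x, exists n, lspan cs (x - nu n);
  tame_coinvariants : exists ts : seq N, forall P : N -> Prop,
    subspace P -> (forall x n, P (pair_actr N x n)) ->
    (forall t, t \in ts -> P t) -> forall n, P n
}.

Hypothesis m_fp : finitely_presented m.

Lemma tame_one : tame (N := tensor_one m) id.
Proof.
split=> //=.
- by exists [::] => n ->; apply: lspan0.
- by exists [::] => x; exists x; rewrite subrr; apply: lspan0.
- have [ms mgen] := finitely_presented_generated m_fp.
  by exists ms => P Ps Pa Pt; apply: mgen.
Qed.

Section Step.
Variables (N : compatible_pair m) (nu : N -> m).
Hypothesis N_tame : tame nu.

Let T := tensor_succ N.
Let aN := pair_actr N.
Let cmN := tame_crossed N_tame.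
Let nuT : T -> m := @tensor_nu _ _ _ (pair_actl N) (pair_actr N).
Let cmT : crossed_module (pair_actr T) nuT := compatible_crossed_tensor N.
Let tn (n : N) (x : m) : T := tens (pair_actl N) (pair_actr N) n x.

Lemma nu_tens n x : nuT (tn n x) = [lie nu n, x].
Proof. by rewrite /nuT (tensor_nu_tens (pair_compat N)) (tame_act N_tame). Qed.

(** The relation for [n ⊗ [x, y]] cancels one of the two terms of the action. *)
Lemma act_tens x n y : pair_actr T x (tn n y) = tn (aN y n) x.
Proof.
rewrite /= (tensor_act_tens (pair_compat N)) (tens_lier _ _ n x y).
by rewrite addrC subrK.
Qed.

Lemma tens_linl x : linear (tn^~ x).
Proof. by move=> k n n'; rewrite /tn tensDl tensZl. Qed.

Lemma tens_linr n : linear (tn n).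
Proof. by move=> k x x'; rewrite /tn tensDr tensZr. Qed.

Lemma tens_bracket n x y : tn n [lie x, y] = tn (aN y n) x - tn (aN x n) y.
Proof. exact: tens_lier. Qed.

(** By [act_tens], [n = y n'] works for [t = n' ⊗ y]. A bracket [[t, t']] is
    again a pure tensor, since it equals [nu t] acting on [t']. *)
Lemma act_factors t :
  exists n, nu n = - nuT t /\ forall x, pair_actr T x t = tn n x.
Proof.
have nul := cm_linear cmN; have nuTl := cm_linear cmT.
elim/tensor_ind: t => [|n y|t t' [n [En an]] [n' [En' an']]|k t [n [En an]]|
                      t t' _ [n' [En' an']]].
- exists 0; rewrite (lin0 nul) (lin0 nuTl) oppr0; split=> // x.
  by rewrite act0r (lin0 (tens_linl x)).
- exists (aN y n); rewrite -/(tn n y) nu_tens (cm_equivariant cmN) -lieC.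
  by split=> // x; apply: act_tens.
- exists (n + n'); rewrite (linD nul) (linD nuTl) opprD En En'; split=> // x.
  by rewrite actDr an an' (linD (tens_linl x)).
- exists (k *: n); rewrite (linZ nul) (linZ nuTl) -scalerN En; split=> // x.
  by rewrite actZr an (linZ (tens_linl x)).
- exists (aN (nuT t) n'); rewrite -(cm_peiffer cmT) an' nu_tens.
  rewrite (cm_equivariant cmN) -lieC; split=> // x; exact: act_tens.
Qed.

(** A tensor [n ⊗ [x, y]] expands into tensors [n' ⊗ x] and [n' ⊗ y] with [n']
    obtained by acting on [n]; this is why the generators of [m] suffice on the right-hand side,
    for the span of [ker nu ⊗ m] as well as for the coinvariants. *)
Lemma tame_succ : tame nuT.
Proof.
have [ms mgen] := finitely_presented_generated m_fp.
have [s0 s0P] := tame_kernel N_tame.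
have [cs csP] := tame_cokernel N_tame.
have [ts tsP] := tame_coinvariants N_tame.
have nul := cm_linear cmN; have nuTl := cm_linear cmT.
have co : exists cs, forall x, exists t, lspan cs (x - nuT t).
  exists (cs ++ map nu ts) => x; have [n cn] := csP x.
  have ss := lspan_sub (cs ++ map nu ts).
  have [t ct] : exists t, lspan (cs ++ map nu ts) (nu n - nuT t).
    move: n {cn}; apply: tsP => [|y n|t tt].
    - split=> [|k n n' [t ct] [t' ct']].
        by exists 0; rewrite (lin0 nul) (lin0 nuTl) subrr; apply: lspan0.
      exists (k *: t + t'); rewrite nul nuTl opprD addrACA -scalerBr.
      exact: ss.2.
    - exists (tn (- n) y); rewrite nu_tens (cm_equivariant cmN) (linN nul).
      by rewrite lieNl -lieC subrr; apply: lspan0.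
    - exists 0; rewrite (lin0 nuTl) subr0; apply: mem_lspan.
      by rewrite mem_cat map_f ?orbT.
  exists t; rewrite -(subrK (nu n) x) -addrA; apply: subspaceD => //.
  by apply: lspan_le cn => u us; rewrite mem_cat us.
have gen : exists ts : seq T, forall P : T -> Prop,
    subspace P -> (forall x t, P (pair_actr T x t)) ->
    (forall t, t \in ts -> P t) -> forall t, P t.
  exists (allpairs tn ts ms) => P Ps Pa Pt.
  have P1 x n y : P (tn (aN x n) y) by rewrite -act_tens.
  have P2 : forall n y, P (tn n y).
    apply: tsP => [|x n|t tt]; last 1 first.
    - apply: mgen => [|x y _ _|x xm].
      + split=> [|k x y Px Py]; first by rewrite (lin0 (tens_linr t)); apply: subspace0.
        by rewrite tens_linr; apply: Ps.2.
      + by rewrite tens_bracket; apply: subspaceB.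
      + by apply: Pt; apply: allpairs_f.
    - split=> [y|k n n' Pn Pn' y].
        by rewrite (lin0 (tens_linl y)); apply: subspace0.
      by rewrite tens_linl; apply: Ps.2.
    - by move=> y; apply: P1.
  elim/tensor_ind => [|n x|t t' Pt1 Pt2|k t Pt1|t t' _ _].
  - exact: subspace0.
  - exact: P2.
  - exact: subspaceD.
  - exact: subspaceZ.
  - by rewrite -(cm_peiffer cmT); apply: Pa.
split=> //.
have [tT tTP] := gen; have [cT cTP] := co.
pose sB := allpairs tn s0 ms.
have sBP : forall x n, nu n = 0 -> lspan sB (tn n x).
  have ss := lspan_sub sB.
  apply: mgen => [|x y Px Py n n0|x xm n n0].
  - split=> [n _|k x y Px Py n n0].
      by rewrite (lin0 (tens_linr n)); apply: lspan0.
    by rewrite tens_linr; apply: ss.2; [apply: Px|apply: Py].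
  - rewrite tens_bracket; apply: subspaceB => //; [apply: Px|apply: Py].
      by rewrite (cm_equivariant cmN) n0 lie0r.
    by rewrite (cm_equivariant cmN) n0 lie0r.
  - apply: lspan_allpairs; [exact: tens_linl|exact: tens_linr|exact: s0P|].
    exact: mem_lspan.
apply: (crossed_module_kernel (sB := sB) m_fp cmT cTP _ tTP) => x t t0.
have [n [En ->]] := act_factors t; apply: sBP.
by rewrite En; move: t0; rewrite /nuT => ->; rewrite oppr0.
Qed.

Lemma image_succ i :
    (forall x, x \in lower_central m i.+1 <-> exists n, nu n = x) ->
  forall x, x \in lower_central m i.+2 <-> exists t, nuT t = x.
Proof.
move=> im x; have nuTl := cm_linear cmT; split.
  move=> /asboolP; elim=> {x} [_ y /im[n <-]||x y _ [t <-] _ [t' <-]|k x _ [t <-]].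
  - by exists (tn n y); apply: nu_tens.
  - by exists 0; apply: lin0.
  - by exists (t + t'); apply: linD.
  - by exists (k *: t); apply: linZ.
case=> t <-; elim/tensor_ind: t => [|n y|t t' Pt Pt'|k t Pt|t t' Pt Pt'].
- by rewrite (lin0 nuTl); apply: rpred0.
- rewrite -/(tn n y) nu_tens; apply/asboolP/in_comm_lie.
  by apply/im; exists n.
- by rewrite (linD nuTl); apply: rpredD.
- by rewrite (linZ nuTl); apply: rpredZ.
- by rewrite (cm_lie cmT); apply: lower_central_ideal.
Qed.

End Step.

Lemma tensor_power_tame i : exists2 nu : tensor_power m i.+1 -> m, tame nu &
  forall x, x \in lower_central m i.+1 <-> exists t, nu t = x.
Proof.
elim: i => [|i [nu nut im]].
  exists id; first exact: tame_one.
  by move=> x; split=> // _; exists x.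
exists (@tensor_nu _ _ _ (pair_actl (tensor_power m i.+1)) (pair_actr _)).
  exact: (tame_succ nut).
exact: (image_succ nut im).
Qed.

End TensorPower.

Theorem theorem4p2 (K : fieldType) (m : lieType K) (i : nat)
    (m_fp : finitely_presented m) (i_ge2 : (2 <= i)%N) :
  finitely_presented (tensor_power m i) <-> finitely_presented (gamma m i).
Proof.
case: i i_ge2 => // i _.
have [nu nut im] := tensor_power_tame m_fp i.
have cm := tame_crossed nut; have nul := cm_linear cm.
have [s sP] := tame_kernel nut.
have nuP t : nu t \in lower_central m i.+1 by apply/im; exists t.
pose f t : gamma m i.+1 := Gamma (nuP t).
apply: (finite_dim_kernel_presented (f := f) (s := s)).
- by move=> k t t'; apply: val_inj; rewrite /= nul.
- by move=> t t'; apply: val_inj; rewrite /= (cm_lie cm).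
- by move=> [x xl]; have /im[t tx] := xl; exists t; apply: val_inj.
- by move=> t /(congr1 val) /= t0; apply: sP.
Qed.
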